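(* Assume the weight sequences satisfy the Weight regularity condition and that the limit $W$ satisfies either (i) $\mathbb E[W^4]<\infty$ or (ii) the power-law tail condition with exponent $\tau\in(3,5]$. Let $\beta_c={\rm asinh}(1/\nu)$ with $\nu=\mathbb E[W^2]/\mathbb E[W]$. Then the annealed critical exponents of the annealed Ising model on $\mathrm{GRG}_N(\boldsymbol w)$ exist and satisfy: if $\mathbb E[W^4]<\infty$: $\boldsymbol\beta=1/2$, $\boldsymbol\delta=3$, $\boldsymbol\gamma=\boldsymbol\gamma'=1$; if $W$ satisfies the power-law condition with $\tau\in(3,5)$: $\boldsymbol\beta=1/(\tau-3)$, $\boldsymbol\delta=\tau-2$, $\boldsymbol\gamma=\boldsymbol\gamma'=1$. In the boundary case $\tau=5$ (power-law condition with $\tau=5$), \[ \widetilde M(\beta,0^+)\asymp \Big(\frac{\beta-\beta_c}{\log(1/(\beta-\beta_c))}\Big)^{1/2}\ \text{ as }\beta\searrow\beta_c,\qquad \widetilde M(\beta_c,B)\asymp\Big(\frac{B}{\log(1/B)}\Big)^{1/3}\ \text{ as }B\searrow 0. \] The same statements hold for the rank-1 inhomogeneous Curie–Weiss model, where the quantities are defined by the same formulas with $\sinh(\beta)$ replaced by $\beta$ and with critical value $\beta_c=1/\nu$.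
   Context: Vertex weights $\boldsymbol w=(w_i)_{i\in[N]}$, $w_i>0$, $\ell_N=\sum_{i\in[N]}w_i$. The generalized random graph $\mathrm{GRG}_N(\boldsymbol w)$ on $[N]$ has independent edges, edge $ij$ present with probability $p_{ij}=w_iw_j/(\ell_N+w_iw_j)$. Let $U_N$ be uniform on $[N]$ and $W_N=w_{U_N}$. Weight regularity condition: there is a random variable $W$ with $W_N\to W$ in distribution, $\mathbb E[W_N^2]=\frac1N\sum_i w_i^2\to\mathbb E[W^2]<\infty$, and $\mathbb E[W]>0$. Power-law tail condition with exponent $\tau$: there exist constants $C_W>c_W>0$ and $w_0>1$ with $c_Ww^{-(\tau-1)}\le \mathbb P(W>w)\le C_Ww^{-(\tau-1)}$ for all $w>w_0$. Annealed Ising model: with $Q_N$ the law of the graph, the annealed measure is $P_N(\sigma)=Q_N\big(\exp[\beta\sum_{(i,j)\in E_N}\sigma_i\sigma_j+B\sum_i\sigma_i]\big)/Q_N(Z_N(\beta,B))$ on $\sigma\in\{-1,1\}^N$, $Z_N$ the partition function. Rank-1 inhomogeneous Curie–Weiss model: measure on $\{-1,1\}^N$ proportional to $\exp\big(\frac12\sum_{i,j\in[N]}J_{ij}\sigma_i\sigma_j+B\sum_i\sigma_i\big)$ with $J_{ij}=\beta w_iw_j/\ell_N$. Limiting annealed quantities (for $\mathrm{GRG}$): let $\alpha(\beta)=\sqrt{\sinh(\beta)/\mathbb E[W]}$. For $B>0$, let $z^*(\beta,B)$ be the unique positive solution of $z=\mathbb E[\tanh(\alpha(\beta)Wz+B)\,\alpha(\beta)W]$,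 and set $\widetilde M(\beta,B)=\mathbb E[\tanh(\alpha(\beta)Wz^*+B)]$ (the limiting annealed magnetization per vertex), $\widetilde M(\beta,0^+)=\lim_{B\searrow0}\widetilde M(\beta,B)$, $\widetilde\chi(\beta,B)=\partial_B\widetilde M(\beta,B)$ (the limiting annealed susceptibility), $\widetilde\chi(\beta,0^+)=\lim_{B\searrow0}\widetilde\chi(\beta,B)$. Critical exponents: $\widetilde M(\beta,0^+)\asymp(\beta-\beta_c)^{\boldsymbol\beta}$ as $\beta\searrow\beta_c$; $\widetilde M(\beta_c,B)\asymp B^{1/\boldsymbol\delta}$ as $B\searrow0$; $\widetilde\chi(\beta,0^+)\asymp(\beta_c-\beta)^{-\boldsymbol\gamma}$ as $\beta\nearrow\beta_c$; $\widetilde\chi(\beta,0^+)\asymp(\beta-\beta_c)^{-\boldsymbol\gamma'}$ as $\beta\searrow\beta_c$. Here $f\asymp g$ means $f/g$ is bounded away from $0$ and $\infty$ in the specified limit. *)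

(* Defs.v *)
From HB Require Import structures.
From mathcomp Require Import all_boot all_order all_algebra.
From mathcomp Require Import all_classical all_reals all_analysis.
Set Implicit Arguments. Unset Strict Implicit. Unset Printing Implicit Defensive.
Import Order.TTheory GRing.Theory Num.Theory.
Import numFieldNormedType.Exports.
Local Open Scope classical_set_scope.
Local Open Scope ring_scope.

Section Defs.
Variable R : realType.

Definition sinh (x : R) : R := (expR x - expR (- x)) / 2.
Definition tanh (x : R) : R := (expR x - expR (- x)) / (expR x + expR (- x)).
Definition asinh (y : R) : R := ln (y + Num.sqrt (y ^+ 2 + 1)).

Definition Ew (mu : probability R R) (f : R -> R) : R :=
  fine (\int[mu]_x (f x)%:E)%E.

Definition EW mu := Ew mu id.
Definition EW2 mu := Ew mu (fun x => x ^+ 2).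
Definition nuW mu := EW2 mu / EW mu.

(* weight regularity: W_N (uniform vertex weight) -> W in distribution,
   E[W_N^2] -> E[W^2] < oo, E[W] > 0.  Weights of GRG_N are w N i, i < N. *)
Definition weight_regularity (w : nat -> nat -> R) (mu : probability R R) : Prop :=
  (forall N i, (i < N)%N -> 0 < w N i) /\
  (forall f : R -> R, continuous f -> (exists M, forall x, `|f x| <= M) ->
     (fun N => (N%:R^-1 * \sum_(i < N) f (w N i))%:E) @ \oo
       --> (\int[mu]_x (f x)%:E)%E) /\
  ((fun N => (N%:R^-1 * \sum_(i < N) w N i ^+ 2)%:E) @ \oo
       --> (\int[mu]_x (x ^+ 2)%:E)%E) /\
  (\int[mu]_x (x ^+ 2)%:E < +oo)%E /\
  (0 < \int[mu]_x x%:E)%E.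

Definition power_law (mu : probability R R) (tau : R) : Prop :=
  exists cW CW w0 : R, 0 < cW /\ cW < CW /\ 1 < w0 /\
    forall x, w0 < x ->
      ((cW * x `^ (- (tau - 1)))%:E <= mu `]x, +oo[%classic <= (CW * x `^ (- (tau - 1)))%:E)%E.

(* g = sinh for GRG, g = id for the rank-1 inhomogeneous Curie-Weiss model *)
Definition alphaW (g : R -> R) mu (beta : R) : R := Num.sqrt (g beta / EW mu).

Definition fpmap (g : R -> R) mu (beta B z : R) : R :=
  Ew mu (fun x => tanh (alphaW g mu beta * x * z + B) * (alphaW g mu beta * x)).

(* z*(beta,B): the (unique) positive solution of z = fpmap z *)
Definition zstar (g : R -> R) mu (beta B : R) : R :=
  xget 0 [set z | 0 < z /\ z = fpmap g mu beta B z].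

Definition Mt (g : R -> R) mu (beta B : R) : R :=
  Ew mu (fun x => tanh (alphaW g mu beta * x * zstar g mu beta B + B)).

Definition Mt0 (g : R -> R) mu (beta : R) : R :=
  lim (Mt g mu beta B @[B --> 0^'+]).

Definition chit (g : R -> R) mu (beta B : R) : R := derive1 (Mt g mu beta) B.

Definition chit0 (g : R -> R) mu (beta : R) : R :=
  lim (chit g mu beta B @[B --> 0^'+]).

Definition asymp (F : set_system R) (f h : R -> R) : Prop :=
  exists c C : R, 0 < c /\ 0 < C /\
    \forall x \near F, c <= f x / h x <= C.

Definition crit_exponents (g : R -> R) mu (bc eb ed eg egp : R) : Prop :=
  (\forall beta \near bc^'+, cvg (Mt g mu beta B @[B --> 0^'+])) /\
  (\forall beta \near bc, forall B, 0 < B -> derivable (Mt g mu beta) B 1) /\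
  (\forall beta \near bc^'-, cvg (chit g mu beta B @[B --> 0^'+])) /\
  (\forall beta \near bc^'+, cvg (chit g mu beta B @[B --> 0^'+])) /\
  asymp bc^'+ (Mt0 g mu) (fun beta => (beta - bc) `^ eb) /\
  asymp 0^'+ (Mt g mu bc) (fun B => B `^ ed^-1) /\
  asymp bc^'- (chit0 g mu) (fun beta => (bc - beta) `^ (- eg)) /\
  asymp bc^'+ (chit0 g mu) (fun beta => (beta - bc) `^ (- egp)).

Definition boundary_case (g : R -> R) mu (bc : R) : Prop :=
  (\forall beta \near bc^'+, cvg (Mt g mu beta B @[B --> 0^'+])) /\
  asymp bc^'+ (Mt0 g mu)
    (fun beta => ((beta - bc) / ln ((beta - bc)^-1)) `^ 2^-1) /\
  asymp 0^'+ (Mt g mu bc) (fun B => (B / ln (B^-1)) `^ 3^-1).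

End Defs.

(* Main.v *)
(** Put [s = g(beta) / E[W]] and [y = alpha z]; the fixed-point equation becomes
[y = s F(y, B)] with [F(y, B) = E[tanh(W y + B) W]], and the critical value of
[s] is [1 / E[W^2]]. Concavity of tanh on the half line gives uniqueness, and
its tangent inequalities show that the solution [y(B)] satisfies
[y' = s P / D] with [P = E[sech^2 W]], [D = 1 - s E[sech^2 W^2] > 0], so that
[chi = E[sech^2] + s P^2 / D]; all of this passes to the limit [B -> 0+].

Everything then reduces to two truncated moments,
[G(y) = E[W^2 min((W y)^2, 1)]] and [L(y) = E[W min((W y)^3, 1)]], because
[x - tanh x] is comparable to [x min(x^2, 1)] and [tanh x - x sech^2 x] is at
least a multiple of [min(x^3, 1)]. For [s > 1 / E[W^2]] and [B = 0] one gets
[G(y) ~ s - 1 / E[W^2]] and [D ~ L(y) / y], and at [s = 1 / E[W^2]] one gets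
[y G(y) ~ B]. Under a finite fourth moment [G(y) ~ y^2] and [L(y) ~ y^3]; under
a power-law tail with exponent in ]3, 5[, [G(y) ~ y^(tau-3)] and
[L(y) ~ y^(tau-2)]; for [tau = 5], [G(y) ~ y^2 log(1/y)]. The tail estimates
come from the dyadic recursions relating [G(y)] to [G(2 y)]. *)
Require Import Defs.
From HB Require Import structures.
From mathcomp Require Import all_boot all_order all_algebra.
From mathcomp Require Import all_classical all_reals all_analysis.
From mathcomp Require Import measurable_realfun ring lra.
Import Order.TTheory GRing.Theory Num.Theory.
Import numFieldNormedType.Exports.
Local Open Scope classical_set_scope.
Local Open Scope ring_scope.

Set Implicit Arguments.
Unset Strict Implicit.
Unset Printing Implicit Defensive.

(** * Hyperbolic tangent *)

Section Tanh.
Context {R : realType}.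
Implicit Types a b x y : R.

(** In general only the second moment of W is finite and tails are known only up to constants, so
    the expectations cannot be Taylor expanded: [tanh] is compared pointwise with truncated powers,
    and only two-sided bounds are integrated.

    Differentiability in B is obtained without an implicit function theorem: concavity bounds the
    increments of the magnetization between two fields by the candidate derivative at either end,
    and continuity of the candidate finishes. The positivity of D used there is quantitative, D >=
    tanh B, and degenerates as B -> 0+. At B = 0 it is recovered from y = 0 below the critical value
    and from the lower bound by L above it.

    The dyadic recursions use only tail probabilities and truncated second moments at the scales
    2^k. Exponent 5 is the resonant case: halving y divides both G(2 y) in the recursion and y^2 by
    4, so each halving adds the same multiple of y^2, and log(1/y) counts the halvings. *)

Definition dtanh x : R := 1 - tanh x ^+ 2.

Lemma cosh_pos x : 0 < expR x + expR (- x).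
Proof. by rewrite addr_gt0 ?expR_gt0. Qed.

Lemma is_derive_tanh x : is_derive x 1 (@tanh R) (dtanh x).
Proof.
have c0 : expR x + expR (- x) != 0 by rewrite gt_eqF ?cosh_pos.
rewrite /tanh; apply: is_derive_eq; rewrite /dtanh /tanh /GRing.scale /=.
by field.
Qed.

Lemma tanh0 : tanh 0 = 0 :> R.
Proof. by rewrite /tanh oppr0 subrr mul0r. Qed.

Lemma tanh_lt1 x : tanh x < 1.
Proof.
by rewrite /tanh ltr_pdivrMr ?cosh_pos// mul1r ltrD2l gt0_cp ?expR_gt0.
Qed.

Lemma tanh_gtN1 x : -1 < tanh x.
Proof.
rewrite /tanh ltr_pdivlMr ?cosh_pos//.
have := expR_gt0 x; lra.
Qed.

Lemma dtanh_gt0 x : 0 < dtanh x.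
Proof. by rewrite /dtanh; have := tanh_lt1 x; have := tanh_gtN1 x; nra. Qed.

Lemma dtanh_le1 x : dtanh x <= 1.
Proof. by rewrite /dtanh; nra. Qed.

Lemma continuous_tanh : continuous (@tanh R).
Proof.
move=> x; apply: differentiable_continuous; apply/derivable1_diffP.
by have [] := is_derive_tanh x.
Qed.

Lemma continuous_dtanh : continuous dtanh.
Proof.
move=> x; apply: cvgB; first exact: cvg_cst.
by rewrite expr2; apply: cvgM; exact: continuous_tanh.
Qed.

Lemma tanh_MVT a b : a <= b ->
  exists2 c, a <= c <= b & tanh b - tanh a = dtanh c * (b - a).
Proof.
move=> ab; have [||c] := @MVT_segment R (@tanh R) dtanh a b ab.
- by move=> x _; exact: is_derive_tanh.
- exact/continuous_subspaceT/continuous_tanh.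
by rewrite in_itv/=; exists c.
Qed.

Lemma ler_tanh a b : a <= b -> tanh a <= tanh b.
Proof.
move=> ab; have [c _ e] := tanh_MVT ab.
rewrite -subr_ge0 e; apply: mulr_ge0; first exact/ltW/dtanh_gt0.
by rewrite subr_ge0.
Qed.

Lemma tanh_ge0 a : 0 <= a -> 0 <= tanh a.
Proof. by move=> /ler_tanh; rewrite tanh0. Qed.

Lemma dtanh_anti a b : 0 <= a -> a <= b -> dtanh b <= dtanh a.
Proof.
move=> a0 ab; rewrite /dtanh lerD2l lerN2.
by rewrite lerXn2r ?nnegrE ?ler_tanh ?tanh_ge0// (le_trans a0).
Qed.

Lemma tanh_tangent a b : 0 <= a -> a <= b ->
  dtanh b * (b - a) <= tanh b - tanh a <= dtanh a * (b - a).
Proof.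
move=> a0 ab; have [c /andP[ac cb] ->] := tanh_MVT ab.
by rewrite !ler_wpM2r ?subr_ge0//= dtanh_anti// (le_trans a0).
Qed.

(** Valid for either order of [a] and [b], so it can be integrated without knowing the sign of the
    increment. *)
Lemma tanh_tangent_le a b : 0 <= a -> 0 <= b ->
  tanh b - tanh a <= dtanh a * (b - a).
Proof.
move=> a0 b0; have [ab|/ltW ba] := leP a b.
  by have /andP[] := tanh_tangent a0 ab.
by have /andP[] := tanh_tangent b0 ba; lra.
Qed.

Lemma tanh_le x : 0 <= x -> tanh x <= x.
Proof.
move=> x0; have /andP[_] := tanh_tangent (lexx 0) x0.
by rewrite /dtanh tanh0 expr0n/=; lra.
Qed.

Lemma tanh_lipschitz a b : 0 <= a -> 0 <= b -> `|tanh a - tanh b| <= `|a - b|.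
Proof.
wlog ab : a b / a <= b.
  move=> h a0 b0; have [/h|/ltW/h] := leP a b; first exact.
  by rewrite distrC (distrC a); exact.
move=> a0 b0; rewrite distrC (distrC a) !ger0_norm ?subr_ge0 ?ler_tanh//.
have /andP[_] := tanh_tangent a0 ab; have := dtanh_le1 a.
nra.
Qed.

Lemma dtanh_lipschitz a b : 0 <= a -> 0 <= b ->
  `|dtanh a - dtanh b| <= 2 * `|a - b|.
Proof.
move=> a0 b0; have := tanh_lipschitz a0 b0.
have -> : dtanh a - dtanh b = - ((tanh a - tanh b) * (tanh a + tanh b)).
  by rewrite /dtanh; ring.
rewrite normrN normrM [X in _ -> X * _ <= _]distrC => h.
rewrite mulrC ler_pM// 1?distrC// ger0_norm ?addr_ge0 ?tanh_ge0//.
have := tanh_lt1 a; have := tanh_lt1 b; lra.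
Qed.

Lemma dtanh_dist_le1 a b : `|dtanh a - dtanh b| <= 1.
Proof.
rewrite ler_norml; have := dtanh_gt0 a; have := dtanh_gt0 b.
have := dtanh_le1 a; have := dtanh_le1 b; lra.
Qed.

(* x * u + B is the convex combination of x * v + B and B with weights u / v and
   1 - u / v, so this is concavity of tanh on the half line. *)
Lemma tanh_chord x B u v : 0 <= x -> 0 <= B -> 0 <= u -> u <= v ->
  u * tanh (x * v + B) + (v - u) * tanh B <= v * tanh (x * u + B).
Proof.
move=> x0 B0 u0 uv; set p := x * u + B; set q := x * v + B.
have p0 : 0 <= p by rewrite addr_ge0// mulr_ge0.
have q0 : 0 <= q by rewrite addr_ge0// mulr_ge0// (le_trans u0).
have h1 := tanh_tangent_le p0 q0; have h2 := tanh_tangent_le p0 B0.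
have : u * (tanh q - tanh p) + (v - u) * (tanh B - tanh p) <=
       u * (dtanh p * (q - p)) + (v - u) * (dtanh p * (B - p)).
  by rewrite lerD// ler_wpM2l// subr_ge0.
have -> : u * (dtanh p * (q - p)) + (v - u) * (dtanh p * (B - p)) = 0.
  by rewrite /p /q; ring.
lra.
Qed.

(** Slope of the chord of [tanh] over [0, 1], hence by concavity a constant for linear lower bounds
    there. *)
Definition tanh1 : R := tanh 1.

Lemma tanh1_gt0 : 0 < tanh1.
Proof.
rewrite /tanh1 /tanh divr_gt0 ?cosh_pos// subr_gt0 ltr_expR; lra.
Qed.

Lemma tanh_ge_min x : 0 <= x -> tanh1 * Num.min x 1 <= tanh x.
Proof.
move=> x0; have [x1|/ltW x1] := leP x 1.
  have := @tanh_chord 1 0 x 1 ler01 (lexx 0) x0 x1.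
  by rewrite tanh0 mulr0 !addr0 !mul1r mulrC.
by rewrite mulr1 ler_tanh.
Qed.

Lemma tanh_le_min x : 0 <= x -> tanh x <= Num.min x 1.
Proof. by move=> x0; rewrite le_min tanh_le//= ltW// tanh_lt1. Qed.

Lemma min_sqr x : 0 <= x -> Num.min x 1 ^+ 2 = Num.min (x ^+ 2) 1.
Proof.
move=> x0; have [x1|x1] := leP x 1.
  by rewrite min_l// expr_le1.
by rewrite min_r ?expr1n// expr_ge1// ltW.
Qed.

(* The gap y - tanh y decreases by at least (y/2) tanh(y/2)^2 from y to y/2. *)
Lemma tanh_gap_ge x : 0 <= x ->
  tanh1 ^+ 2 / 8 * (x * Num.min (x ^+ 2) 1) <= x - tanh x.
Proof.
move=> x0; have h0 : 0 <= x / 2 by lra.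
have /andP[_ h] : dtanh x * (x - x / 2) <= tanh x - tanh (x / 2) <= dtanh (x / 2) * (x - x / 2).
  by apply: tanh_tangent => //; lra.
have h2 := tanh_le h0; rewrite /dtanh in h.
have h3 := tanh_ge_min h0.
have m0 : 0 <= Num.min (x / 2) 1 by rewrite le_min h0 ler01.
have h4 : tanh1 ^+ 2 * Num.min (x / 2) 1 ^+ 2 <= tanh (x / 2) ^+ 2.
  rewrite -exprMn lerXn2r// ?nnegrE ?tanh_ge0// mulr_ge0//.
  exact/ltW/tanh1_gt0.
(* Halving the argument costs a factor 4 in the truncated square; with the prefactor x/2 this
   produces the 8. *)
have h5 : Num.min (x ^+ 2) 1 <= 4 * Num.min (x / 2) 1 ^+ 2.
  rewrite -min_sqr//; have : Num.min x 1 <= 2 * Num.min (x / 2) 1.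
    by have [?|?] := leP x 1; have [?|?] := leP (x / 2) 1; lra.
  have : 0 <= Num.min x 1 by rewrite le_min x0 ler01.
  nra.
have h6 : tanh1 ^+ 2 * Num.min (x ^+ 2) 1 <= 4 * tanh (x / 2) ^+ 2.
  have := sqr_ge0 tanh1; nra.
nra.
Qed.

Lemma tanh_gap_le x : 0 <= x -> x - tanh x <= x * Num.min (x ^+ 2) 1.
Proof.
move=> x0; have /andP[h _] := tanh_tangent (lexx 0) x0.
rewrite tanh0 /dtanh !subr0 in h; rewrite -min_sqr//.
have := tanh_le_min x0; have := tanh_ge0 x0 => h1 h2.
have : tanh x ^+ 2 <= Num.min x 1 ^+ 2.
  by rewrite lerXn2r// nnegrE// (le_trans h1).
nra.
Qed.

Lemma tanh_gap_mono a b : 0 <= a -> a <= b -> a - tanh a <= b - tanh b.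
Proof.
move=> a0 ab; have := tanh_lipschitz a0 (le_trans a0 ab).
rewrite distrC (distrC a) !ger0_norm ?subr_ge0 ?ler_tanh//; lra.
Qed.

Definition tanh_dgap_cst : R := tanh1 * dtanh 1 / 4.

Lemma tanh_dgap_cst_gt0 : 0 < tanh_dgap_cst.
Proof. by rewrite /tanh_dgap_cst divr_gt0// mulr_gt0 ?tanh1_gt0 ?dtanh_gt0. Qed.

Lemma tanh_dgap_mono a b : 0 <= a -> a <= b ->
  tanh a - a * dtanh a <= tanh b - b * dtanh b.
Proof.
move=> a0 ab; have /andP[h _] := tanh_tangent a0 ab.
have := dtanh_anti a0 ab; nra.
Qed.

(** Tangent bounds on [0, x/2] and on [x/2, x] give a gap of at least (x/2) (dtanh (x/2) - dtanh x),
    that is (x/2) (tanh x - tanh (x/2)) (tanh x + tanh (x/2)). Both factors are at least linear in x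
    on [0, 1]; the two halves make the 1/4 in [tanh_dgap_cst]. *)
Lemma tanh_dgap_ge_cube x : 0 <= x -> x <= 1 ->
  tanh_dgap_cst * x ^+ 3 <= tanh x - x * dtanh x.
Proof.
move=> x0 x1; have h0 : 0 <= x / 2 by lra.
have hx : x / 2 <= x by lra.
have /andP[h1 h1'] := tanh_tangent h0 hx.
have /andP[h2 _] := tanh_tangent (lexx 0) h0.
have T0 := tanh_ge0 x0; have T0' := tanh_ge0 h0.
have Tx := tanh_ge_min x0; rewrite (min_l x1) in Tx.
have S1 := dtanh_anti x0 x1; have S0 := dtanh_gt0 1.
have k0 := tanh1_gt0.
rewrite tanh0 in h2.
have e : tanh x ^+ 2 - tanh (x / 2) ^+ 2 = dtanh (x / 2) - dtanh x.
  by rewrite /dtanh; ring.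
have f1 : x / 2 * (tanh x ^+ 2 - tanh (x / 2) ^+ 2) <= tanh x - x * dtanh x.
  by rewrite e; nra.
apply: le_trans f1.
have f2 : dtanh 1 * (x / 2) <= tanh x - tanh (x / 2) by nra.
have f3 : dtanh 1 * (x / 2) * (tanh1 * x) <=
    (tanh x - tanh (x / 2)) * (tanh x + tanh (x / 2)).
  apply: ler_pM => //; [by rewrite mulr_ge0// ltW|by rewrite mulr_ge0// ltW|lra].
have -> : tanh_dgap_cst * x ^+ 3 = x / 2 * (dtanh 1 * (x / 2) * (tanh1 * x)).
  by rewrite /tanh_dgap_cst; field.
by rewrite ler_wpM2l// subr_sqr.
Qed.

Lemma tanh_dgap_ge x : 0 <= x ->
  tanh_dgap_cst * Num.min (x ^+ 3) 1 <= tanh x - x * dtanh x.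
Proof.
move=> x0; have [x1|/ltW x1] := leP x 1.
  by rewrite min_l ?expr_le1//; exact: tanh_dgap_ge_cube.
rewrite min_r ?expr_ge1// mulr1; apply: le_trans (tanh_dgap_mono ler01 x1).
by have := tanh_dgap_ge_cube ler01 (lexx 1); rewrite expr1n mulr1.
Qed.

Lemma dtanh_gap_le x : 0 <= x -> 1 - dtanh x <= Num.min (x ^+ 2) 1.
Proof.
move=> x0; rewrite -min_sqr// /dtanh opprB addrC subrK.
by rewrite lerXn2r ?tanh_le_min ?nnegrE ?le_min ?tanh_ge0 ?x0 ?ler01.
Qed.

Lemma tanh_dgap_le x : 0 <= x -> tanh x - x * dtanh x <= x * Num.min (x ^+ 2) 1.
Proof. by move=> x0; have := dtanh_gap_le x0; have := tanh_le x0; nra. Qed.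

End Tanh.

#[local] Opaque tanh dtanh.

(** * Expectations of functions of at most quadratic growth *)

(* The weight distribution is carried by the half line, so integrands are
   precomposed with the absolute value: then all pointwise estimates are only
   needed for nonnegative arguments. *)
Definition Ex {R : realType} (mu : probability R R) (f : R -> R) : R :=
  \int[mu]_x f `|x|.

(** The growth bound is asked only on the half line, where |x| takes its values, while measurability
    is global so that it survives composition with the absolute value. Degrees add under products;
    degree 2 is the largest that a finite second moment integrates. *)
Definition adm {R : realType} (i : nat) (f : R -> R) : Prop :=
  measurable_fun setT f /\
  exists2 C, 0 <= C & forall x, 0 <= x -> `|f x| <= C * (1 + x) ^+ i.

Section Admissible.
Context {R : realType}.
Implicit Types (f g : R -> R) (i j : nat).

Lemma admW i j f : (i <= j)%N -> adm i f -> adm j f.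
Proof.
move=> ij [mf [C C0 h]]; split=> //; exists C => // x x0.
apply: le_trans (h x x0) _; rewrite ler_wpM2l// ler_weXn2l// lerDl//.
Qed.

Lemma adm_cst c : adm 0 (fun=> c : R).
Proof.
by split; [exact: measurable_cst|exists `|c| => // x _; rewrite expr0 mulr1].
Qed.

Lemma adm_id : adm 1 (fun x : R => x).
Proof.
split; first exact: measurable_id.
by exists 1 => // x x0; rewrite expr1 mul1r ger0_norm// lerDr.
Qed.

Lemma adm_add i j f g : adm i f -> adm j g ->
  adm (maxn i j) (fun x => f x + g x).
Proof.
move=> /(admW (leq_maxl i j)) [mf [C C0 hf]] /(admW (leq_maxr i j)) [mg [D D0 hg]].
split; first exact: measurable_funD.
exists (C + D); first exact: addr_ge0.
move=> x x0; rewrite mulrDl; apply: le_trans (ler_normD _ _) _.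
by rewrite lerD ?hf ?hg.
Qed.

Lemma adm_mul i j f g : adm i f -> adm j g -> adm (i + j) (fun x => f x * g x).
Proof.
move=> [mf [C C0 hf]] [mg [D D0 hg]]; split; first exact: measurable_funM.
exists (C * D); first exact: mulr_ge0.
by move=> x x0; rewrite normrM exprD mulrACA ler_pM ?hf ?hg.
Qed.

Lemma adm_opp i f : adm i f -> adm i (fun x => - f x).
Proof.
move=> [mf [C C0 hf]]; split.
  by apply: measurableT_comp => //; exact: measurable_funN.
by exists C => // x x0; rewrite normrN hf.
Qed.

Lemma adm_sub i j f g : adm i f -> adm j g ->
  adm (maxn i j) (fun x => f x - g x).
Proof. by move=> af /adm_opp; exact: adm_add. Qed.

Lemma adm_scale i c f : adm i f -> adm i (fun x => c * f x).
Proof. exact: (adm_mul (adm_cst c)). Qed.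

Lemma adm_sqr : adm 2 (fun x : R => x ^+ 2).
Proof. exact: (adm_mul adm_id adm_id). Qed.

Lemma adm_min1 f : measurable_fun setT f -> (forall x, 0 <= x -> 0 <= f x) ->
  adm 0 (fun x => Num.min (f x) 1).
Proof.
move=> mf f0; split.
  by apply: measurable_minr => //; exact: measurable_cst.
exists 1 => // x x0; rewrite expr0 mulr1 ger0_norm ?le_min ?f0 ?ler01//.
by rewrite ge_min lexx orbT.
Qed.

Lemma measurable_affine (y B : R) : measurable_fun setT (fun x : R => x * y + B).
Proof.
by apply: measurable_funD => //; apply: measurable_funM.
Qed.

Lemma adm_tanh (y B : R) : adm 0 (fun x => tanh (x * y + B)).
Proof.
split.
  apply: measurableT_comp; last exact: measurable_affine.
  exact: continuous_measurable_fun continuous_tanh.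
exists 1 => // x x0; rewrite expr0 mulr1 ler_norml.
by rewrite (ltW (tanh_gtN1 _)) ltW// tanh_lt1.
Qed.

Lemma adm_dtanh (y B : R) : adm 0 (fun x => dtanh (x * y + B)).
Proof.
split.
  apply: measurableT_comp; last exact: measurable_affine.
  exact: continuous_measurable_fun continuous_dtanh.
exists 1 => // x x0; rewrite expr0 mulr1 ler_norml.
by rewrite dtanh_le1 andbT (le_trans _ (ltW (dtanh_gt0 _)))// lerN10.
Qed.

Definition indgt (s x : R) : R := if s < x then 1 else 0.

Lemma indgt_ge0 s x : 0 <= indgt s x.
Proof. by rewrite /indgt; case: ifP. Qed.

Lemma indgt_le1 s x : indgt s x <= 1.
Proof. by rewrite /indgt; case: ifP. Qed.

Lemma indgtE s : indgt s = \1_(`]s, +oo[%classic : set R).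
Proof.
apply/funext => x; rewrite /indgt indicE.
case: (boolP (s < x)) => sx.
  by rewrite mem_set//= in_itv/= sx.
by rewrite memNset//= in_itv/= (negbTE sx).
Qed.

Lemma adm_indgt s : adm 0 (indgt s).
Proof.
split; first by rewrite indgtE; exact: measurable_indic.
exists 1 => // x x0; rewrite expr0 mulr1 ger0_norm ?indgt_ge0//.
exact: indgt_le1.
Qed.

End Admissible.

Lemma adm_tanh0 {R : realType} (y : R) : adm 0 (fun x => tanh (x * y)).
Proof.
rewrite (_ : (fun x => _) = fun x => tanh (x * y + 0)); first exact: adm_tanh.
by apply/funext => x; rewrite addr0.
Qed.

Lemma adm_dtanh0 {R : realType} (y : R) : adm 0 (fun x => dtanh (x * y)).
Proof.
rewrite (_ : (fun x => _) = fun x => dtanh (x * y + 0)); first exact: adm_dtanh.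
by apply/funext => x; rewrite addr0.
Qed.

Lemma adm_min_lin {R : realType} (t : R) : 0 <= t ->
  adm 0 (fun x : R => Num.min (x * t) 1).
Proof.
move=> t0; apply: adm_min1 => [|x x0]; last exact: mulr_ge0.
exact: measurable_funM.
Qed.

Lemma adm_min_pow {R : realType} n (t : R) : 0 <= t ->
  adm 0 (fun x : R => Num.min ((x * t) ^+ n) 1).
Proof.
move=> t0; apply: adm_min1 => [|x x0]; last by rewrite exprn_ge0// mulr_ge0.
by apply: measurable_funX; exact: measurable_funM.
Qed.

Ltac adm_rec :=
  lazymatch goal with
  | |- adm _ (fun _ => ?c) => exact (adm_cst c)
  | |- adm _ (fun x => x) => exact adm_id
  | |- adm _ (fun x => x ^+ 2) => exact adm_sqr
  | |- adm _ (fun x => tanh (x * ?y + ?B)) => exact (adm_tanh y B)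
  | |- adm _ (fun x => dtanh (x * ?y + ?B)) => exact (adm_dtanh y B)
  | |- adm _ (fun x => tanh (x * ?y)) => exact (adm_tanh0 y)
  | |- adm _ (fun x => dtanh (x * ?y)) => exact (adm_dtanh0 y)
  | |- adm _ (fun x => indgt ?s x) => exact (adm_indgt s)
  | |- adm _ (fun x => Num.min (x * ?t) 1) => apply (@adm_min_lin _ t); by []
  | |- adm _ (fun x => Num.min ((x * ?t) ^+ ?n) 1) =>
      apply (@adm_min_pow _ n t); by []
  | |- adm _ (fun x => @?f x - @?g x) => eapply (@adm_sub _ _ _ f g); adm_rec
  | |- adm _ (fun x => @?f x + @?g x) => eapply (@adm_add _ _ _ f g); adm_rec
  | |- adm _ (fun x => - @?f x) => eapply (@adm_opp _ _ f); adm_rec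
  | |- adm _ (fun x => @?f x * @?g x) => eapply (@adm_mul _ _ _ f g); adm_rec
  end.
Ltac adm := cbv beta; solve [eapply admW; last (by adm_rec); by []].

(** Modulus of continuity available with two moments only: it tends to 0 with [t], at no prescribed
    rate. *)
HB.lock Definition omega {R : realType} (mu : probability R R) (t : R) : R :=
  Ex mu (fun x => x ^+ 2 * Num.min (x * t) 1).

Section Expectation.
Context {R : realType} (mu : probability R R).
Hypothesis mu_sqr : (\int[mu]_x (x ^+ 2)%:E < +oo)%E.
Implicit Types (f g : R -> R) (i : nat).
Local Notation E := (Ex mu).
Local Notation omega := (omega mu).

Lemma integrable_sqr : mu.-integrable setT (fun x => (x ^+ 2)%:E).
Proof.
apply/integrableP; split.
  by apply/measurable_EFinP; apply: measurable_funX.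
by under eq_integral do rewrite gee0_abs ?lee_fin ?sqr_ge0//.
Qed.

Lemma adm_integrable f : adm 2 f ->
  mu.-integrable setT (fun x => (f `|x|)%:E).
Proof.
move=> [mf [C C0 h]].
have mn : measurable_fun setT (fun x : R => f `|x|).
  by apply: measurableT_comp => //; exact: normr_measurable.
have i1 : mu.-integrable setT (fun x => (C * 2)%:E * (1 + x ^+ 2)%:E)%E.
  apply: integrableZl => //.
  apply: (@integrableD _ _ _ mu setT measurableT (cst 1%:E) (fun x => (x ^+ 2)%:E)).
    exact: finite_measure_integrable_cst.
  exact: integrable_sqr.
apply: le_integrable i1 => //; first exact/measurable_EFinP.
move=> x _; rewrite -EFinM !abse_EFin lee_fin.
apply: le_trans (h _ (normr_ge0 x)) _.
rewrite [leRHS]ger0_norm; last first.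
  by rewrite mulr_ge0// ?mulr_ge0// addr_ge0// sqr_ge0.
rewrite -mulrA ler_wpM2l// -(real_normK (num_real x)).
have := sqr_ge0 (`|x| - 1); nra.
Qed.

Lemma ExD f g : adm 2 f -> adm 2 g -> E (fun x => f x + g x) = E f + E g.
Proof. by move=> af ag; rewrite /Ex RintegralD//; exact: adm_integrable. Qed.

Lemma ExZ c f : adm 2 f -> E (fun x => c * f x) = c * E f.
Proof. by move=> af; rewrite /Ex RintegralZl//; exact: adm_integrable. Qed.

Lemma ExB f g : adm 2 f -> adm 2 g -> E (fun x => f x - g x) = E f - E g.
Proof.
move=> af ag; rewrite /Ex RintegralB//; exact: adm_integrable.
Qed.

Lemma Ex_cst c : E (fun=> c) = c.
Proof. by rewrite /Ex Rintegral_cst// [X in fine X]probability_setT mulr1. Qed.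

Lemma eq_Ex f g : (forall x, 0 <= x -> f x = g x) -> E f = E g.
Proof. by move=> fg; apply: eq_Rintegral => x _; rewrite fg. Qed.

Lemma le_Ex f g : adm 2 f -> adm 2 g -> (forall x, 0 <= x -> f x <= g x) ->
  E f <= E g.
Proof.
move=> af ag fg; apply: le_Rintegral => //; [exact: adm_integrable..|].
by move=> x _; exact: fg.
Qed.

Lemma Ex_ge0 f : (forall x, 0 <= x -> 0 <= f x) -> 0 <= E f.
Proof. by move=> f0; apply: Rintegral_ge0 => x _; exact: f0. Qed.

Lemma le_normr_Ex f g : adm 2 f -> adm 2 g ->
  (forall x, 0 <= x -> `|f x| <= g x) -> `|E f| <= E g.
Proof.
move=> af ag fg; rewrite ler_norml -(mulN1r (E g)) -ExZ//; apply/andP; split.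
  apply: le_Ex => //; first by apply: adm_scale.
  by move=> x /fg; rewrite ler_norml mulN1r => /andP[].
by apply: le_Ex => // x /fg; rewrite ler_norml => /andP[].
Qed.

Lemma adm_omega (t : R) : 0 <= t ->
  adm 2 (fun x : R => x ^+ 2 * Num.min (x * t) 1).
Proof. by move=> t0; exact: (adm_mul adm_sqr (adm_min_lin t0)). Qed.

Lemma omega_mono (s t : R) : 0 <= s -> s <= t -> omega s <= omega t.
Proof.
move=> s0 st; rewrite omega.unlock; apply: le_Ex; rewrite ?adm_omega// ?(le_trans s0)//.
  exact: adm_omega.
  by apply: adm_omega; exact: le_trans st.
move=> x x0; rewrite ler_wpM2l ?sqr_ge0// le_min ge_min ler_wpM2l//=.
by rewrite ge_min lexx orbT.
Qed.

(** Dominated convergence along t = 1/(n+1), with dominating function x^2; pointwise the integrand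
    is at most |x|^3/(n+1). *)
Lemma omega_small (e : R) : 0 < e -> exists2 d, 0 < d & omega d <= e.
Proof.
move=> e0.
pose fn n (x : R) := (`|x| ^+ 2 * Num.min (`|x| * n.+1%:R^-1) 1)%:E.
have H := @dominated_convergence _ _ R mu setT measurableT fn (cst 0%E)
  (fun x => (`|x| ^+ 2)%:E).
have mfn n : measurable_fun (setT : set R) (fn n).
  apply/measurable_EFinP.
  have n0 : 0 <= n.+1%:R^-1 :> R by rewrite invr_ge0.
  have [m _] := adm_omega n0.
  by apply: (measurableT_comp m); exact: normr_measurable.
have [] := H.
- by [].
- exact: measurable_cst.
- apply/aeW => x _; rewrite /fn /=; apply: cvg_EFin; first exact: nearW.
  apply: (@squeeze_cvgr _ _ _ _ (cst 0) (fun n => `|x| ^+ 3 * n.+1%:R^-1)).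
  + apply: nearW => n /=; apply/andP; split.
      by rewrite mulr_ge0// ?exprn_ge0// le_min mulr_ge0//=.
    by rewrite (exprSr _ 2) -mulrA ler_wpM2l ?exprn_ge0// ge_min lexx.
  + exact: cvg_cst.
  + rewrite -[X in _ --> X](mulr0 (`|x| ^+ 3)); apply: cvgM; first exact: cvg_cst.
    exact: cvg_harmonic.
- exact: adm_integrable adm_sqr.
- apply/aeW => x n _; rewrite /fn abse_EFin lee_fin ger0_norm; last first.
    by rewrite mulr_ge0// ?exprn_ge0// le_min mulr_ge0//=.
  by rewrite ler_piMr ?exprn_ge0// ge_min lexx orbT.
move=> _ _; rewrite integral_cst// mul0e => /fine_cvgP[_] /cvgrPdist_le /(_ _ e0).
case=> n _ /(_ n (leqnn _)) /=; rewrite sub0r normrN => h.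
exists n.+1%:R^-1; first by rewrite invr_gt0.
by apply: le_trans h; rewrite omega.unlock /Ex /Rintegral; exact: ler_norm.
Qed.

End Expectation.

(** * Moments and the functionals of the fixed-point equation *)

HB.lock Definition mean {R : realType} (mu : probability R R) : R :=
  Ex mu (fun x => x).

HB.lock Definition meansq {R : realType} (mu : probability R R) : R :=
  Ex mu (fun x => x ^+ 2).

HB.lock Definition fF {R : realType} (mu : probability R R) (y B : R) : R :=
  Ex mu (fun x => tanh (x * y + B) * x).

HB.lock Definition fM {R : realType} (mu : probability R R) (y B : R) : R :=
  Ex mu (fun x => tanh (x * y + B)).

(** These three play the role of partial derivatives: [fQ] and [fP] for [fF] in [y] and [B], [fP]
    and [fS] for [fM] in [y] and [B]. *)
HB.lock Definition fS {R : realType} (mu : probability R R) (y B : R) : R :=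
  Ex mu (fun x => dtanh (x * y + B)).

HB.lock Definition fP {R : realType} (mu : probability R R) (y B : R) : R :=
  Ex mu (fun x => dtanh (x * y + B) * x).

HB.lock Definition fQ {R : realType} (mu : probability R R) (y B : R) : R :=
  Ex mu (fun x => dtanh (x * y + B) * x ^+ 2).

Section Functionals.
Context {R : realType} (mu : probability R R).
Hypothesis mu_sqr : (\int[mu]_x (x ^+ 2)%:E < +oo)%E.
Implicit Types y B u v : R.
Local Notation E := (Ex mu).

Local Notation m1 := (mean mu).
Local Notation m2 := (meansq mu).
Local Notation fF := (fF mu).
Local Notation fM := (fM mu).
Local Notation fS := (fS mu).
Local Notation fP := (fP mu).
Local Notation fQ := (fQ mu).

Lemma meansq_ge0 : 0 <= m2.
Proof. by rewrite meansq.unlock; apply: Ex_ge0 => x x0; exact: sqr_ge0. Qed.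

Lemma Ex_linear a b : E (fun x => x * a + b) = m1 * a + b.
Proof.
rewrite mean.unlock ExD//; [|by adm..]; rewrite Ex_cst.
by congr (_ + _); rewrite mulrC -ExZ//; [apply: eq_Ex => x _; rewrite mulrC|adm].
Qed.

Lemma Ex_quadratic a b : E (fun x => x ^+ 2 * a + x * b) = m2 * a + m1 * b.
Proof.
rewrite mean.unlock meansq.unlock ExD//; [|by adm..]; congr (_ + _).
  by rewrite mulrC -ExZ//; [apply: eq_Ex => x _; rewrite mulrC|adm].
by rewrite mulrC -ExZ//; [apply: eq_Ex => x _; rewrite mulrC|adm].
Qed.

Lemma fF0 B : fF 0 B = tanh B * m1.
Proof.
rewrite fF.unlock mean.unlock; transitivity (E (fun x => tanh B * x)).
  by apply: eq_Ex => x _; rewrite mulr0 add0r.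
by apply: ExZ => //; adm.
Qed.

Lemma fF_le y B : fF y B <= m1.
Proof.
rewrite fF.unlock mean.unlock.
apply: le_Ex => //; [by adm..|] => x x0.
by rewrite ler_piMl// ltW// tanh_lt1.
Qed.

Lemma affine_ge0 x y B : 0 <= x -> 0 <= y -> 0 <= B -> 0 <= x * y + B.
Proof. by move=> *; rewrite addr_ge0// mulr_ge0. Qed.

Lemma fP_ge0 y B : 0 <= fP y B.
Proof. by rewrite fP.unlock; apply: Ex_ge0 => x x0; rewrite mulr_ge0// ltW// dtanh_gt0. Qed.

Lemma fS_ge0 y B : 0 <= fS y B.
Proof. by rewrite fS.unlock; apply: Ex_ge0 => x x0; rewrite ltW// dtanh_gt0. Qed.

Lemma fP_le y B : fP y B <= m1.
Proof.
rewrite fP.unlock mean.unlock.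
apply: le_Ex => //; [by adm..|] => x x0.
by rewrite ler_piMl// dtanh_le1.
Qed.

Lemma fS_le1 y B : fS y B <= 1.
Proof.
rewrite fS.unlock -[leRHS](Ex_cst mu); apply: le_Ex => //; [by adm..|] => x x0.
exact: dtanh_le1.
Qed.

Lemma fF_chord B u v : 0 <= B -> 0 <= u -> u <= v ->
  u * fF v B + (v - u) * fF 0 B <= v * fF u B.
Proof.
move=> B0 u0 uv; rewrite fF.unlock -!ExZ//; [|by adm..].
rewrite -ExD//; [|by adm..].
apply: le_Ex => //; [by adm..|] => x x0.
rewrite mulr0 add0r.
have := ler_wpM2r x0 (tanh_chord x0 B0 u0 uv); lra.
Qed.

(** Joint concavity replaces differentiation under the integral sign: the tangent inequality of
    [tanh] at x y + B is integrated against x. *)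
Lemma fF_tangent y B y' B' : 0 <= y -> 0 <= B -> 0 <= y' -> 0 <= B' ->
  fF y' B' - fF y B <= fQ y B * (y' - y) + fP y B * (B' - B).
Proof.
move=> y0 B0 y'0 B'0; rewrite mulrC [fP y B * _]mulrC.
rewrite fF.unlock fQ.unlock fP.unlock -!ExZ//; [|by adm..].
rewrite -ExD//; [|by adm..]; rewrite -ExB//; [|by adm..].
apply: le_Ex => //; [by adm..|] => x x0.
have := tanh_tangent_le (affine_ge0 x0 y0 B0) (affine_ge0 x0 y'0 B'0).
move=> /(ler_wpM2r x0); lra.
Qed.

Lemma fM_tangent y B y' B' : 0 <= y -> 0 <= B -> 0 <= y' -> 0 <= B' ->
  fM y' B' - fM y B <= fP y B * (y' - y) + fS y B * (B' - B).
Proof.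
move=> y0 B0 y'0 B'0; rewrite mulrC [fS y B * _]mulrC.
rewrite fM.unlock fS.unlock fP.unlock -!ExZ//; [|by adm..].
rewrite -ExD//; [|by adm..]; rewrite -ExB//; [|by adm..].
apply: le_Ex => //; [by adm..|] => x x0.
have := tanh_tangent_le (affine_ge0 x0 y0 B0) (affine_ge0 x0 y'0 B'0).
nra.
Qed.

(** Joint continuity relative to the closed quadrant, so that it applies at the boundary B = 0 and
    to limits from the right. *)
Definition jcont (h : R -> R -> R) : Prop := forall y B, 0 <= y -> 0 <= B ->
  forall e, 0 < e -> exists2 d, 0 < d & forall y' B', 0 <= y' -> 0 <= B' ->
    `|y - y'| <= d -> `|B - B'| <= d -> `|h y B - h y' B'| <= e.

Lemma jcont_lipschitz h (K L : R) :
  (forall y B y' B', 0 <= y -> 0 <= B -> 0 <= y' -> 0 <= B' ->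
     `|h y B - h y' B'| <= K * `|y - y'| + L * `|B - B'|) -> jcont h.
Proof.
move=> H y B y0 B0 e e0; exists (e / (1 + `|K| + `|L|)).
  by rewrite divr_gt0// -addrA ltr_wpDr// addr_ge0.
move=> y' B' y'0 B'0 hy hB; apply: le_trans (H _ _ _ _ y0 B0 y'0 B'0) _.
set d := e / _ in hy hB.
have d0 : 0 <= d by apply: le_trans hy.
have -> : e = d * (1 + `|K| + `|L|).
  by rewrite /d divfK// gt_eqF// -addrA ltr_wpDr// addr_ge0.
have h1 : K * `|y - y'| <= `|K| * d.
  by rewrite (le_trans (ler_wpM2r _ (ler_norm K)))// ler_wpM2l.
have h2 : L * `|B - B'| <= `|L| * d.
  by rewrite (le_trans (ler_wpM2r _ (ler_norm L)))// ler_wpM2l.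
nra.
Qed.

Lemma affine_dist x y B y' B' : 0 <= x ->
  `|(x * y + B) - (x * y' + B')| <= x * `|y - y'| + `|B - B'|.
Proof.
move=> x0; have -> : x * y + B - (x * y' + B') = x * (y - y') + (B - B') by ring.
by apply: le_trans (ler_normD _ _) _; rewrite normrM (ger0_norm x0).
Qed.

Lemma jcont_fF : jcont fF.
Proof.
apply: (@jcont_lipschitz _ m2 m1) => y B y' B' y0 B0 y'0 B'0.
rewrite -Ex_quadratic fF.unlock -ExB//; [|by adm..].
apply: le_normr_Ex => //; [by adm..|] => x x0.
rewrite -mulrBl normrM (ger0_norm x0).
have -> : x ^+ 2 * `|y - y'| + x * `|B - B'| =
  (x * `|y - y'| + `|B - B'|) * x by ring.
rewrite ler_wpM2r//.
apply: le_trans (affine_dist y B y' B' x0).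
by apply: tanh_lipschitz; exact: affine_ge0.
Qed.

Lemma jcont_fM : jcont fM.
Proof.
apply: (@jcont_lipschitz _ m1 1) => y B y' B' y0 B0 y'0 B'0.
rewrite mul1r -Ex_linear fM.unlock -ExB//; [|by adm..].
apply: le_normr_Ex => //; [by adm..|] => x x0.
apply: le_trans (affine_dist y B y' B' x0).
by apply: tanh_lipschitz; exact: affine_ge0.
Qed.

Lemma jcont_fS : jcont fS.
Proof.
apply: (@jcont_lipschitz _ (m1 * 2) 2) => y B y' B' y0 B0 y'0 B'0.
rewrite -mulrA -Ex_linear fS.unlock -ExB//; [|by adm..].
apply: le_normr_Ex => //; [by adm..|] => x x0.
have := affine_dist y B y' B' x0.
have := dtanh_lipschitz (affine_ge0 x0 y0 B0) (affine_ge0 x0 y'0 B'0).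
lra.
Qed.

Lemma jcont_fP : jcont fP.
Proof.
apply: (@jcont_lipschitz _ (m2 * 2) (m1 * 2)) => y B y' B' y0 B0 y'0 B'0.
rewrite -!mulrA -Ex_quadratic fP.unlock -ExB//; [|by adm..].
apply: le_normr_Ex => //; [by adm..|] => x x0.
rewrite -mulrBl normrM (ger0_norm x0).
have := affine_dist y B y' B' x0.
have := dtanh_lipschitz (affine_ge0 x0 y0 B0) (affine_ge0 x0 y'0 B'0).
nra.
Qed.

(** The increment of [dtanh] is at most 1 and at most 2 (x |y - y'| + |B - B'|). Only the part in
    [y] is truncated, since x^2 times x need not be integrable. *)
Lemma fQ_dist y B y' B' : 0 <= y -> 0 <= B -> 0 <= y' -> 0 <= B' ->
  `|fQ y B - fQ y' B'| <= omega mu (2 * `|y - y'|) + 2 * `|B - B'| * m2.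
Proof.
move=> y0 B0 y'0 B'0.
have t0 : 0 <= 2 * `|y - y'| by rewrite mulr_ge0.
rewrite fQ.unlock meansq.unlock -ExB//; [|by adm..]; rewrite omega.unlock -ExZ//; last by adm.
rewrite -ExD//; [|by adm..].
apply: le_normr_Ex => //; [by adm..|] => x x0.
rewrite -mulrBl normrM (ger0_norm (sqr_ge0 x)).
have h1 := affine_dist y B y' B' x0.
have h2 := dtanh_lipschitz (affine_ge0 x0 y0 B0) (affine_ge0 x0 y'0 B'0).
have h3 := dtanh_dist_le1 (x * y + B) (x * y' + B').
have h4 : `|dtanh (x * y + B) - dtanh (x * y' + B')| <=
    Num.min (x * (2 * `|y - y'|)) 1 + 2 * `|B - B'|.
  have [?|?] := leP (x * (2 * `|y - y'|)) 1; first lra.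
  have := normr_ge0 (B - B'); lra.
have := sqr_ge0 x; nra.
Qed.

(* A Lipschitz bound would need a third moment, hence the modulus omega. *)
Lemma jcont_fQ : jcont fQ.
Proof.
move=> y B y0 B0 e e0.
have [|d d0 hd] := @omega_small R mu mu_sqr (e / 2); first lra.
have D0 : 0 < 4 * (1 + m2) by have := meansq_ge0; lra.
exists (Num.min (d / 2) (e / (4 * (1 + m2)))).
  by rewrite lt_min !divr_gt0.
move=> y' B' y'0 B'0; rewrite !le_min => /andP[hy _] /andP[_ hB].
apply: le_trans (fQ_dist y0 B0 y'0 B'0) _.
have h1 : omega mu (2 * `|y - y'|) <= e / 2.
  apply: le_trans hd; apply: omega_mono => //; lra.
rewrite ler_pdivlMr// in hB.
have := normr_ge0 (B - B'); have := meansq_ge0; nra.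
Qed.

Lemma jcont_cvg h T (F : set_system T) (FF : Filter F) (f g : T -> R) y B :
  jcont h -> 0 <= y -> 0 <= B ->
  (\forall t \near F, 0 <= f t /\ 0 <= g t) ->
  f @ F --> y -> g @ F --> B -> (fun t => h (f t) (g t)) @ F --> h y B.
Proof.
move=> hh y0 B0 fg0 fy gB; apply/cvgrPdist_le => e e0.
have [d d0 H] := hh y B y0 B0 e e0.
near=> t; have [f0 g0] : 0 <= f t /\ 0 <= g t by near: t.
apply: H => //; near: t.
  by move/cvgrPdist_le : fy; exact.
by move/cvgrPdist_le : gB; exact.
Unshelve. all: by end_near. Qed.

Definition fD s y B : R := 1 - s * fQ y B.
Definition fchi s y B : R := fS y B + s * fP y B ^+ 2 / fD s y B.

Lemma fchi_cvg s T (F : set_system T) (FF : Filter F) (f g : T -> R) y B :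
  0 <= y -> 0 <= B -> fD s y B != 0 ->
  (\forall t \near F, 0 <= f t /\ 0 <= g t) ->
  f @ F --> y -> g @ F --> B -> (fun t => fchi s (f t) (g t)) @ F --> fchi s y B.
Proof.
move=> y0 B0 D0 fg0 fy gB; apply: cvgD.
  exact: jcont_cvg jcont_fS _ _ _ _ _.
apply: cvgM.
  apply: cvgM; first exact: cvg_cst.
  by rewrite expr2; apply: cvgM; exact: jcont_cvg jcont_fP _ _ _ _ _.
apply: cvgV => //; apply: cvgB; first exact: cvg_cst.
by apply: cvgM; [exact: cvg_cst|exact: jcont_cvg jcont_fQ _ _ _ _ _].
Qed.

End Functionals.

(** * The fixed point and the limit of vanishing field *)

(* The hypothesis says that c v and c u bound the slope of f on [u, v], so f is
   concave with derivative c wherever c is continuous. *)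
Lemma is_derive_slope_squeeze {R : realType} (f c : R -> R) (b : R) : 0 < b ->
  (forall u v, 0 < u -> u < v ->
     c v * (v - u) <= f v - f u <= c u * (v - u)) ->
  c @ b --> c b -> is_derive b 1 f (c b).
Proof.
move=> b0 H cb.
suff : h^-1 *: (f (h *: 1 + b) - f b) @[h --> 0^'] --> c b.
  move=> h; split; last exact: cvg_lim h.
  by apply/cvg_ex; exists (c b).
apply/cvgrPdist_le => e e0.
move/cvgrPdist_le : cb => /(_ _ e0) [d /= d0 hd].
exists (Num.min d b); first by rewrite /= lt_min d0 b0.
move=> h /=; rewrite sub0r normrN lt_min => /andP[hd1 hb] h0.
rewrite scaler1 -[_ *: _]/(_ * _).
have bh : 0 < h + b by move: hb; rewrite ltr_norml; lra.
have hc : `|c b - c (h + b)| <= e.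
  by apply: hd => /=; rewrite opprD addrCA subrr addr0 normrN.
have : Num.min (c b) (c (h + b)) <= h^-1 * (f (h + b) - f b) <=
       Num.max (c b) (c (h + b)).
  have [hp|hn|hz] := ltgtP h 0; last by rewrite hz eqxx in h0.
  - have /andP[h1 h2] : c b * (b - (h + b)) <= f b - f (h + b) <= c (h + b) * (b - (h + b)).
      by apply: H => //; lra.
    have -> : h^-1 * (f (h + b) - f b) = (f b - f (h + b)) / (- h).
      by field.
    rewrite ge_min le_max; apply/andP; split; apply/orP; [left|right].
      by rewrite ler_pdivlMr ?oppr_gt0//; lra.
    by rewrite ler_pdivrMr ?oppr_gt0//; lra.
  - have /andP[h1 h2] : c (h + b) * ((h + b) - b) <= f (h + b) - f b <= c b * ((h + b) - b).
      by apply: H => //; lra.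
    rewrite mulrC ge_min le_max; apply/andP; split; apply/orP; [right|left].
      by rewrite ler_pdivlMr//; lra.
    by rewrite ler_pdivrMr//; lra.
move: hc; rewrite !ler_norml; case: (leP (c b) (c (h + b))) => _; lra.
Qed.

(** The default 0 is never taken when [B], [s] and the mean are positive: [fixpoint_exists] then
    supplies a solution. *)
HB.lock Definition ystar {R : realType} (mu : probability R R) (s B : R) : R :=
  xget 0 [set y | 0 < y /\ y = s * fF mu y B].

HB.lock Definition y0 {R : realType} (mu : probability R R) (s : R) : R :=
  lim (ystar mu s B @[B --> 0^'+]).

Section FixedPoint.
Context {R : realType} (mu : probability R R).
Hypothesis mu_sqr : (\int[mu]_x (x ^+ 2)%:E < +oo)%E.
Hypothesis mean_gt0 : 0 < mean mu.
Variable s : R.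
Hypothesis s_gt0 : 0 < s.
Implicit Types y B : R.
Local Notation m1 := (mean mu).
Local Notation m2 := (meansq mu).
Local Notation F := (fF mu).
Local Notation D := (fD mu s).
Local Notation ystar := (ystar mu s).
Local Notation y0 := (y0 mu s).

Lemma tanh_gt0 B : 0 < B -> 0 < tanh B.
Proof.
move=> B0; apply: lt_le_trans (tanh_ge_min (ltW B0)).
by rewrite mulr_gt0 ?tanh1_gt0// lt_min B0 ltr01.
Qed.

Lemma fixpoint_exists B : 0 < B -> exists y, 0 < y /\ y = s * F y B.
Proof.
move=> B0; pose b := s * m1 + 1.
have b0 : 0 <= b by rewrite addr_ge0// mulr_ge0// ltW.
(* The absolute values extend the map continuously to negative [y], where nothing is known about
   [fF]. It is at most 0 at 0, and at least 1 at [b] because F is bounded by the mean. *)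
have [||y] := @IVT R (fun y => `|y| - s * F `|y| B) 0 b 0 b0.
- apply: continuous_subspaceT => y.
  have ny : `|z| @[z --> y] --> `|y| by exact: norm_continuous.
  apply: cvgB; first exact: ny.
  apply: cvgM; first exact: cvg_cst.
  apply: (jcont_cvg _ (jcont_fF mu_sqr)) => //; [exact: ltW| |exact: cvg_cst].
  by apply: nearW => t; split => //; exact: ltW.
- rewrite normr0 (ger0_norm b0) fF0// ge_min le_max; apply/andP; split.
    apply/orP; left; rewrite sub0r oppr_le0 mulr_ge0 ?(ltW s_gt0)// mulr_ge0 ?(ltW mean_gt0)//.
    exact/ltW/tanh_gt0.
  apply/orP; right; rewrite subr_ge0 /b.
  by rewrite (le_trans (ler_wpM2l (ltW s_gt0) (fF_le mu_sqr b B)))// lerDl.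
rewrite in_itv/= => /andP[y0 _]; rewrite ger0_norm// => /eqP.
rewrite subr_eq0 => /eqP e; exists y; split => //.
rewrite lt_neqAle y0 andbT; apply/eqP => y00; move: e.
rewrite -y00 fF0// => e.
have := mulr_gt0 s_gt0 (mulr_gt0 (tanh_gt0 B0) mean_gt0).
by rewrite -e ltxx.
Qed.

(** The chord of the concave map F(., B) from 0 to z starts at the positive height tanh B * m1, so
    at any y in ]0, z[ it lies strictly above the ray through the origin on which both solutions
    lie. *)
Lemma fixpoint_unique B y z : 0 < B -> 0 < y -> y = s * F y B ->
  0 < z -> z = s * F z B -> y = z.
Proof.
move=> B0; wlog yz : y z / y <= z.
  move=> H y0 ey z0 ez; have [/H|/ltW/H h] := leP y z; first exact.
  by symmetry; exact: h.
move=> y0 ey z0 ez; have := fF_chord mu_sqr (ltW B0) (ltW y0) yz.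
rewrite fF0//; have t0 := mulr_gt0 (tanh_gt0 B0) mean_gt0 => h.
apply/eqP; rewrite eq_le yz /= -subr_le0.
have : s * ((z - y) * (tanh B * m1)) <= 0.
  have : s * (y * F z B + (z - y) * (tanh B * m1)) <= s * (z * F y B).
    by rewrite ler_wpM2l// ltW.
  have -> : s * (z * F y B) = z * y by rewrite mulrCA -ey.
  rewrite mulrDr (mulrCA s y) -ez; lra.
by rewrite mulrA pmulr_lle0// mulrC pmulr_lle0// .
Qed.

Lemma ystarP B : 0 < B -> 0 < ystar B /\ ystar B = s * F (ystar B) B.
Proof.
move=> /fixpoint_exists [y hy]; rewrite ystar.unlock.
exact: (@xgetPex _ 0 [set y | 0 < y /\ y = s * F y B] (ex_intro _ y hy)).
Qed.

Lemma ystar_gt0 B : 0 < B -> 0 < ystar B.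
Proof. by case/ystarP. Qed.

Lemma ystar_fix B : 0 < B -> ystar B = s * F (ystar B) B.
Proof. by case/ystarP. Qed.

Lemma ystar_le B : 0 < B -> ystar B <= s * m1.
Proof. by move=> B0; rewrite ystar_fix// ler_wpM2l ?fF_le// ltW. Qed.

(** The tangent of F at the solution, evaluated at y = 0, gives y D >= s tanh B m1, while y <= s
    m1. *)
Lemma fD_ge B : 0 < B -> tanh B <= D (ystar B) B.
Proof.
move=> B0; have y0 := ystar_gt0 B0; have ey := ystar_fix B0.
have := fF_tangent mu_sqr (ltW y0) (ltW B0) (lexx 0) (ltW B0).
rewrite fF0// subrr mulr0 addr0 sub0r => h.
have h1 : s * (tanh B * m1) <= ystar B * D (ystar B) B.
  rewrite /fD mulrBr mulr1 {1}ey.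
  have : s * (tanh B * m1 - F (ystar B) B) <= s * (fQ mu (ystar B) B * - ystar B).
    by rewrite ler_wpM2l// ltW.
  lra.
have h2 := ystar_le B0; have T0 := tanh_gt0 B0.
rewrite -(ler_pM2l y0); apply: le_trans h1.
have := ler_wpM2r (ltW T0) h2; lra.
Qed.

Lemma fD_gt0 B : 0 < B -> 0 < D (ystar B) B.
Proof. by move=> B0; apply: lt_le_trans (fD_ge B0); exact: tanh_gt0. Qed.

(** One-sided discrete form of y' = s P / D: the two fixed-point equations are subtracted and the
    tangent inequality is taken at the first solution. Exchanging the fields gives the other
    side. *)
Lemma ystar_step B B' : 0 < B -> 0 < B' ->
  (ystar B' - ystar B) * D (ystar B) B <= s * fP mu (ystar B) B * (B' - B).
Proof.
move=> B0 B'0; have y0 := ltW (ystar_gt0 B0); have y'0 := ltW (ystar_gt0 B'0).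
have := fF_tangent mu_sqr y0 (ltW B0) y'0 (ltW B'0).
move=> /(ler_wpM2l (ltW s_gt0)); rewrite mulrBr -(ystar_fix B'0) -(ystar_fix B0) /fD; lra.
Qed.

Lemma ystar_nondecreasing B B' : 0 < B -> B <= B' -> ystar B <= ystar B'.
Proof.
move=> B0 BB'; have B'0 := lt_le_trans B0 BB'.
have := ystar_step B'0 B0; have := fD_gt0 B'0.
have h : 0 <= s * fP mu (ystar B') B' by rewrite mulr_ge0 ?fP_ge0// ltW.
have : s * fP mu (ystar B') B' * (B - B') <= 0.
  by rewrite mulr_ge0_le0// subr_le0.
move=> h1 h2 h3; have := le_trans h3 h1.
by rewrite pmulr_lle0// subr_le0.
Qed.

Lemma ystar_lipschitz b B B' : 0 < b -> b <= B -> b <= B' ->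
  `|ystar B - ystar B'| <= s * m1 / tanh b * `|B - B'|.
Proof.
move=> b0; wlog BB' : B B' / B <= B'.
  move=> H h1 h2; have [/H|/ltW/H h] := leP B B'; first exact.
  by rewrite distrC (distrC B); exact: h.
move=> bB bB'; have B0 := lt_le_trans b0 bB; have B'0 := lt_le_trans b0 bB'.
have h0 := ystar_nondecreasing B0 BB'.
rewrite distrC (distrC B) !ger0_norm ?subr_ge0//.
have Tb := tanh_gt0 b0.
rewrite mulrAC ler_pdivlMr//.
have h1 : tanh b <= D (ystar B) B by apply: le_trans (fD_ge B0); exact: ler_tanh.
have h2 : (ystar B' - ystar B) * tanh b <= (ystar B' - ystar B) * D (ystar B) B.
  by rewrite ler_wpM2l// subr_ge0.
apply: le_trans h2 (le_trans (ystar_step B0 B'0) _).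
by rewrite ler_wpM2r ?subr_ge0// ler_wpM2l ?fP_le// ltW.
Qed.

Lemma ystar_cvg b : 0 < b -> ystar B @[B --> (b : R)] --> ystar b.
Proof.
move=> b0; have h0 : 0 < b / 2 by lra.
pose K := s * m1 / tanh (b / 2).
have K0 : 0 < K by rewrite divr_gt0 ?tanh_gt0// mulr_gt0.
apply/cvgrPdist_le => e e0; near=> B.
have hB : b / 2 <= B.
  have : `|b - B| <= b / 2 by near: B; apply: cvgr_dist_le h0; exact: cvg_id.
  by rewrite ler_norml; lra.
have hb : b / 2 <= b by lra.
apply: le_trans (ystar_lipschitz h0 hb hB) _.
rewrite -/K mulrC -ler_pdivlMr//.
by near: B; apply: cvgr_dist_le; [exact: cvg_id|rewrite divr_gt0].
Unshelve. all: by end_near. Qed.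

Definition mag B : R := fM mu (ystar B) B.
Definition chi B : R := fchi mu s (ystar B) B.

(** The tangent of M at each end bounds the increment by P dy + S dB; since P >= 0, the bound of
    [ystar_step] on dy can be inserted. The two ends give the two inequalities. *)
Lemma mag_slope u v : 0 < u -> u < v ->
  chi v * (v - u) <= mag v - mag u <= chi u * (v - u).
Proof.
move=> u0 uv; have v0 := lt_trans u0 uv.
have yu := ltW (ystar_gt0 u0); have yv := ltW (ystar_gt0 v0).
have Du := fD_gt0 u0; have Dv := fD_gt0 v0.
have h1 := fM_tangent mu_sqr yu (ltW u0) yv (ltW v0).
have h2 := fM_tangent mu_sqr yv (ltW v0) yu (ltW u0).
have k1 := ystar_step u0 v0; have k2 := ystar_step v0 u0.
have e1 : ystar v - ystar u <= s * fP mu (ystar u) u / D (ystar u) u * (v - u).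
  by rewrite mulrAC ler_pdivlMr.
have e2 : ystar u - ystar v <= s * fP mu (ystar v) v / D (ystar v) v * (u - v).
  by rewrite mulrAC ler_pdivlMr.
have {}e1 := ler_wpM2l (fP_ge0 mu (ystar u) u) e1.
have {}e2 := ler_wpM2l (fP_ge0 mu (ystar v) v) e2.
rewrite /chi /fchi /mag; apply/andP; split; lra.
Qed.

Lemma chi_cvg b : 0 < b -> chi @ (b : R) --> chi b.
Proof.
move=> b0; apply: fchi_cvg => //; [exact/ltW/ystar_gt0|exact: ltW| | |exact: ystar_cvg].
  by rewrite gt_eqF// fD_gt0.
near=> t; have t0 : 0 < t by near: t; exact: lt_nbhsr.
by split; [exact/ltW/ystar_gt0|exact: ltW].
Unshelve. all: by end_near. Qed.

Lemma is_derive_mag B : 0 < B -> is_derive B 1 mag (chi B).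
Proof.
by move=> B0; apply: is_derive_slope_squeeze => //; [exact: mag_slope|exact: chi_cvg].
Qed.

(** Monotonicity and positivity are what survives near 0: the Lipschitz constant of
    [ystar_lipschitz] blows up there. *)
Lemma ystar_cvg0 : ystar B @[B --> 0^'+] --> y0.
Proof.
rewrite y0.unlock; apply: (@nondecreasing_at_right_is_cvgr R ystar 0).
- apply: nearW => x u v; rewrite !in_itv/= => /andP[u0 _] _ uv.
  exact: ystar_nondecreasing.
- apply: nearW => z; exists 0; move=> w [u /=]; rewrite in_itv/= => /andP[u0 _] <-.
  exact/ltW/ystar_gt0.
Qed.

Lemma near_ystar_ge0 : \forall B \near 0^'+, 0 <= ystar B /\ 0 <= B :> R.
Proof.
near=> B; have B0 : 0 < B by near: B; exact: nbhs_right_gt.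
by split; [exact/ltW/ystar_gt0|exact: ltW].
Unshelve. all: by end_near. Qed.

Lemma y0_ge d : (forall B, 0 < B -> d <= ystar B) -> d <= y0.
Proof.
move=> h; have := ystar_cvg0; rewrite y0.unlock => hc.
apply: limr_ge; first by apply/cvg_ex; exists (lim (ystar B @[B --> 0^'+])).
near=> B; apply: h; near: B; exact: nbhs_right_gt.
Unshelve. all: by end_near. Qed.

Lemma y0_ge0 : 0 <= y0.
Proof. by apply: y0_ge => B /ystar_gt0/ltW. Qed.

Lemma cvg_at_right0 : (B @[B --> 0^'+] --> (0 : R)).
Proof. by apply: cvg_at_right_filter; exact: cvg_id. Qed.

Lemma y0_fix : y0 = s * F y0 0.
Proof.
have h1 : s * F (ystar B) B @[B --> 0^'+] --> s * F y0 0.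
  apply: cvgM; first exact: cvg_cst.
  apply: (jcont_cvg _ (jcont_fF mu_sqr) y0_ge0 (lexx 0) near_ystar_ge0).
    exact: ystar_cvg0.
  exact: cvg_at_right0.
have h2 : s * F (ystar B) B @[B --> 0^'+] --> y0.
  apply: cvg_trans ystar_cvg0; apply: near_eq_cvg; near=> B.
  by rewrite -ystar_fix//; near: B; exact: nbhs_right_gt.
exact: (cvg_unique _ h2 h1).
Unshelve. all: by end_near. Qed.

Lemma mag_cvg0 : mag B @[B --> 0^'+] --> fM mu y0 0.
Proof.
apply: (jcont_cvg _ (jcont_fM mu_sqr) y0_ge0 (lexx 0) near_ystar_ge0).
  exact: ystar_cvg0.
exact: cvg_at_right0.
Qed.

(** The bound D >= tanh B says nothing in the limit, so non-vanishing of the limit of D is a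
    hypothesis, to be verified on each side of the critical value. *)
Lemma chi_cvg0 : D y0 0 != 0 -> chi B @[B --> 0^'+] --> fchi mu s y0 0.
Proof.
move=> D0; apply: (fchi_cvg mu_sqr _ y0_ge0 (lexx 0) D0 near_ystar_ge0).
  exact: ystar_cvg0.
exact: cvg_at_right0.
Qed.

End FixedPoint.

(** * Truncated moments *)

HB.lock Definition gG {R : realType} (mu : probability R R) (y : R) : R :=
  Ex mu (fun x => x ^+ 2 * Num.min ((x * y) ^+ 2) 1).

HB.lock Definition gL {R : realType} (mu : probability R R) (y : R) : R :=
  Ex mu (fun x => x * Num.min ((x * y) ^+ 3) 1).

(** Lower slope of the magnetization at small y, because min(x, 1) y <= min(x y, 1) for 0 <= y <=
    1. *)
HB.lock Definition trmean {R : realType} (mu : probability R R) : R :=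
  Ex mu (fun x => Num.min (x * 1) 1).

Section GapEstimates.
Context {R : realType} (mu : probability R R).
Hypothesis mu_sqr : (\int[mu]_x (x ^+ 2)%:E < +oo)%E.
Hypothesis mean_gt0 : 0 < mean mu.
Implicit Types y B : R.
Local Notation E := (Ex mu).
Local Notation m1 := (mean mu).
Local Notation m2 := (meansq mu).
Local Notation G := (gG mu).
Local Notation L := (gL mu).

Definition gapc : R := tanh1 ^+ 2 / 8.

Lemma gapc_gt0 : 0 < gapc.
Proof. by rewrite /gapc divr_gt0// exprn_gt0// tanh1_gt0. Qed.

Lemma min1_ge0 (a : R) : 0 <= a -> 0 <= Num.min a 1.
Proof. by move=> a0; rewrite le_min a0 ler01. Qed.

Lemma min1_mono (a b : R) : a <= b -> Num.min a 1 <= Num.min b 1.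
Proof. by move=> ab; rewrite le_min !ge_min ab lexx orbT. Qed.

Lemma gG_mono u v : 0 <= u -> u <= v -> G u <= G v.
Proof.
move=> u0 uv; have v0 := le_trans u0 uv.
rewrite gG.unlock; apply: le_Ex => //; [by adm..|] => x x0.
rewrite ler_wpM2l ?sqr_ge0// min1_mono// lerXn2r ?nnegrE ?mulr_ge0//.
by rewrite ler_wpM2l.
Qed.

Lemma gG_le_omega y : 0 <= y -> G y <= omega mu y.
Proof.
move=> y0; rewrite gG.unlock omega.unlock.
apply: le_Ex => //; [by adm..|] => x x0.
have xy : 0 <= x * y by exact: mulr_ge0.
rewrite ler_wpM2l ?sqr_ge0// -min_sqr//.
rewrite expr2 ler_piMl ?min1_ge0// ge_min lexx orbT//.
Qed.

Lemma gG_le y : 0 <= y -> G y <= m2.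
Proof.
move=> y0; rewrite gG.unlock meansq.unlock.
apply: le_Ex => //; [by adm..|] => x x0.
by rewrite ler_piMr ?sqr_ge0// ge_min lexx orbT.
Qed.

Lemma gL_le y : 0 <= y -> L y <= y * G y.
Proof.
move=> y0; rewrite gL.unlock gG.unlock -ExZ//; last by adm.
apply: le_Ex => //; [by adm..|] => x x0.
have xy : 0 <= x * y by exact: mulr_ge0.
have -> : y * (x ^+ 2 * Num.min ((x * y) ^+ 2) 1) =
  x * (x * y * Num.min ((x * y) ^+ 2) 1) by ring.
rewrite ler_wpM2l//; move: (x * y) xy => a a0.
have [a1|/ltW a1] := leP a 1.
  by rewrite !min_l ?expr_le1// exprS.
by rewrite !min_r ?expr_ge1// mulr1.
Qed.

(* Integrate x <= A min(x,1) + x^2/A, which holds for every A >= 1. *)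
Lemma trmean_gt0 : 0 < trmean mu.
Proof.
pose A := 1 + 2 * m2 / m1.
have m20 : 0 <= m2 by exact: meansq_ge0.
have A1 : 1 <= A by rewrite lerDl divr_ge0// ?(ltW mean_gt0)// mulr_ge0.
have A0 : 0 < A by lra.
have h : m1 <= A * trmean mu + A^-1 * m2.
  rewrite mean.unlock trmean.unlock meansq.unlock -!ExZ//; [|by adm..].
  rewrite -ExD//; [|by adm..].
  apply: le_Ex => //; [by adm..|] => x x0.
  rewrite mulr1; have i0 : 0 <= A^-1 * x ^+ 2 by rewrite mulr_ge0 ?sqr_ge0// invr_ge0 ltW.
  have [x1|/ltW x1] := leP x 1.
    by rewrite (le_trans (ler_peMl x0 A1))// lerDl.
  rewrite mulr1; have [xA|/ltW Ax] := leP x A; first by rewrite (le_trans xA)// lerDl.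
  have : x <= A^-1 * x ^+ 2.
    by rewrite mulrC ler_pdivlMr// expr2 ler_wpM2l.
  lra.
have : A^-1 * m2 < m1.
  have e : m1 * A = m1 + 2 * m2 by rewrite /A; field; rewrite gt_eqF.
  rewrite (mulrC A^-1) ltr_pdivrMr// e; have := mean_gt0; lra.
rewrite -(pmulr_rgt0 _ A0); lra.
Qed.

(* q^4 >= 4 a^3 q - 3 a^4 (tangent at a), applied to q = min(x, 1), a = E[q]. *)
Lemma gG_gt0 y : 0 < y -> 0 < G y.
Proof.
(* Capping y at 1 gives t q <= 1 for q = min(x, 1), hence t^2 q^2 <= min((x t)^2, 1). *)
move=> y0; pose t := Num.min y 1.
have t0 : 0 < t by rewrite lt_min y0 ltr01.
have t0' : 0 <= t by exact: ltW.
have ty : t <= y by rewrite ge_min lexx.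
apply: lt_le_trans (gG_mono (ltW t0) ty).
pose a := trmean mu; have a0 : 0 < a by exact: trmean_gt0.
suff : t ^+ 2 * a ^+ 4 <= G t.
  by apply: lt_le_trans; rewrite mulr_gt0// exprn_gt0.
pose K := t ^+ 2 * (4 * a ^+ 3); pose C := t ^+ 2 * (3 * a ^+ 4).
have ea : E (fun x => Num.min (x * 1) 1) = a by rewrite /a trmean.unlock.
have -> : t ^+ 2 * a ^+ 4 = K * E (fun x => Num.min (x * 1) 1) - C.
  by rewrite ea /K /C; ring.
rewrite -[X in _ - X](Ex_cst mu) -ExZ//; last by adm.
rewrite -ExB//; [|by adm..]; rewrite gG.unlock.
apply: le_Ex => //; [by adm..|] => x x0.
rewrite mulr1; set q := Num.min x 1.
have q0 : 0 <= q by exact: min1_ge0.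
have q1 : q <= 1 by rewrite ge_min lexx orbT.
have qx : q <= x by rewrite ge_min lexx.
have h1 : t ^+ 2 * q ^+ 2 <= Num.min ((x * t) ^+ 2) 1.
  rewrite le_min exprMn mulrC ler_wpM2r ?sqr_ge0 ?lerXn2r//=.
  by rewrite mulr_ile1 ?sqr_ge0// expr_le1// ?(ltW t0)// ge_min lexx orbT.
have h2 : t ^+ 2 * q ^+ 4 <= x ^+ 2 * Num.min ((x * t) ^+ 2) 1.
  have -> : t ^+ 2 * q ^+ 4 = q ^+ 2 * (t ^+ 2 * q ^+ 2) by ring.
  have q2 : q ^+ 2 <= x ^+ 2 by rewrite lerXn2r.
  have p0 : 0 <= t ^+ 2 * q ^+ 2 by apply: mulr_ge0; exact: sqr_ge0.
  exact: ler_pM (sqr_ge0 q) p0 q2 h1.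
apply: le_trans h2; rewrite -subr_ge0.
have -> : t ^+ 2 * q ^+ 4 - (K * q - C) =
   t ^+ 2 * ((q - a) ^+ 2 * (q ^+ 2 + 2 * q * a + 3 * a ^+ 2)) by rewrite /K /C; ring.
apply: mulr_ge0; first exact: sqr_ge0.
apply: mulr_ge0; first exact: sqr_ge0.
have := mulr_ge0 q0 (ltW a0); have := sqr_ge0 q; have := sqr_ge0 a; lra.
Qed.

Lemma gapE y B : 0 <= y -> 0 <= B -> y * m2 + B * m1 - fF mu y B =
  E (fun x => ((x * y + B) - tanh (x * y + B)) * x).
Proof.
move=> y0 B0; rewrite meansq.unlock mean.unlock fF.unlock -!ExZ//; [|by adm..].
rewrite -ExD//; [|by adm..]; rewrite -ExB//; [|by adm..].
by apply: eq_Ex => x x0; ring.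
Qed.

Lemma gap_ge y B : 0 <= y -> 0 <= B ->
  gapc * (y * G y) <= y * m2 + B * m1 - fF mu y B.
Proof.
move=> y0 B0; rewrite gapE// mulrA gG.unlock -ExZ//; last by adm.
apply: le_Ex => //; [by adm..|] => x x0.
have xy : 0 <= x * y by exact: mulr_ge0.
have h1 := tanh_gap_ge xy.
have h2 : x * y - tanh (x * y) <= (x * y + B) - tanh (x * y + B).
  by apply: tanh_gap_mono => //; lra.
have := ler_wpM2r x0 (le_trans h1 h2); rewrite /gapc.
move: (Num.min _ _) => m; lra.
Qed.

(** Leaving out B m1 makes the upper bound uniform in the field, since F increases with B; this
    keeps [ystar] away from 0 above the critical value. *)
Lemma gap_le0 y B : 0 <= y -> 0 <= B -> y * m2 - fF mu y B <= y * G y.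
Proof.
move=> y0 B0; rewrite gG.unlock meansq.unlock fF.unlock -!ExZ//; [|by adm..].
rewrite -ExB//; [|by adm..].
apply: le_Ex => //; [by adm..|] => x x0.
have xy : 0 <= x * y by exact: mulr_ge0.
have h1 := tanh_gap_le xy.
have h2 : tanh (x * y) <= tanh (x * y + B) by apply: ler_tanh; lra.
have := ler_wpM2r x0 h1; have := ler_wpM2r x0 h2.
move: (Num.min _ _) => m; lra.
Qed.

(** The gap is increasing, so at a + b it is at most its value at twice the larger of the two. The
    [b] part is left as an untruncated cube: integrated against x it costs only the mean. *)
Lemma tanh_gap_add (a b : R) : 0 <= a -> 0 <= b ->
  (a + b) - tanh (a + b) <= 8 * (a * Num.min (a ^+ 2) 1) + 8 * b ^+ 3.
Proof.
have gap0 (c : R) : 0 <= c -> 0 <= c - tanh c by move=> /tanh_le; lra.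
have gap2 (c : R) : 0 <= c -> c * 2 - tanh (c * 2) <= 8 * (c * Num.min (c ^+ 2) 1).
  move=> c0; have c2 : 0 <= c * 2 by lra.
  apply: le_trans (tanh_gap_le c2) _.
  have : Num.min ((c * 2) ^+ 2) 1 <= 4 * Num.min (c ^+ 2) 1.
    rewrite exprMn; have := sqr_ge0 c.
    by have [?|?] := leP (c ^+ 2) 1; have [?|?] := leP (c ^+ 2 * 2 ^+ 2) 1; lra.
  move=> /(ler_wpM2l c2); move: (Num.min _ _) => m; move: (Num.min _ _) => m'; lra.
move=> a0 b0; have ga := gap2 _ a0; have gb := gap2 _ b0.
have gb' : b * 2 - tanh (b * 2) <= 8 * b ^+ 3.
  apply: le_trans gb _; rewrite ler_wpM2l// exprS ler_wpM2l//.
  by rewrite ge_min lexx.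
have a2 : 0 <= a * 2 by lra.
have b2 : 0 <= b * 2 by lra.
have := gap0 _ a2; have := gap0 _ b2.
have ab0 : 0 <= a + b by lra.
have [ab|/ltW ba] := leP a b.
  have := @tanh_gap_mono _ (a + b) (b * 2) ab0; lra.
have := @tanh_gap_mono _ (a + b) (a * 2) ab0; lra.
Qed.

Lemma gap_le y B : 0 <= y -> 0 <= B ->
  y * m2 + B * m1 - fF mu y B <= 8 * (y * G y) + 8 * B ^+ 3 * m1.
Proof.
move=> y0 B0; rewrite gapE// mulrA gG.unlock mean.unlock -!ExZ//; [|by adm..].
rewrite -ExD//; [|by adm..].
apply: le_Ex => //; [by adm..|] => x x0.
have xy : 0 <= x * y by exact: mulr_ge0.
have := ler_wpM2r x0 (tanh_gap_add xy B0).
move: (Num.min _ _) => m; lra.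
Qed.

(** At a fixed point with B = 0 this difference is y D / s, so its size determines that of D. *)
Lemma dgapE y : 0 <= y -> fF mu y 0 - y * fQ mu y 0 =
  E (fun x => (tanh (x * y + 0) - x * y * dtanh (x * y + 0)) * x).
Proof.
move=> y0; rewrite fF.unlock fQ.unlock -!ExZ//; [|by adm..].
rewrite -ExB//; [|by adm..].
by apply: eq_Ex => x x0; ring.
Qed.

Lemma dgap_ge y : 0 <= y ->
  tanh_dgap_cst * L y <= fF mu y 0 - y * fQ mu y 0.
Proof.
move=> y0; rewrite dgapE// gL.unlock -ExZ//; last by adm.
apply: le_Ex => //; [by adm..|] => x x0; rewrite addr0.
have xy : 0 <= x * y by exact: mulr_ge0.
have := ler_wpM2r x0 (tanh_dgap_ge xy).
move: (Num.min _ _) => m; lra.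
Qed.

Lemma dgap_le y : 0 <= y -> fF mu y 0 - y * fQ mu y 0 <= y * G y.
Proof.
move=> y0; rewrite dgapE// gG.unlock -ExZ//; last by adm.
apply: le_Ex => //; [by adm..|] => x x0; rewrite addr0.
have xy : 0 <= x * y by exact: mulr_ge0.
have := ler_wpM2r x0 (tanh_dgap_le xy).
move: (Num.min _ _) => m; lra.
Qed.

Lemma fM_ge y B : 0 <= y -> y <= 1 -> 0 <= B ->
  tanh1 * trmean mu * y <= fM mu y B.
Proof.
move=> y0 y1 B0; rewrite mulrAC fM.unlock trmean.unlock -ExZ//; last by adm.
apply: le_Ex => //; [by adm..|] => x x0; rewrite mulr1.
have xy : 0 <= x * y by exact: mulr_ge0.
apply: le_trans (_ : tanh (x * y) <= _); last by apply: ler_tanh; lra.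
apply: le_trans (tanh_ge_min xy).
rewrite -mulrA ler_wpM2l ?(ltW tanh1_gt0)// le_min.
have h0 := min1_ge0 x0.
have h1 : Num.min x 1 <= x by rewrite ge_min lexx.
have h2 : Num.min x 1 <= 1 by rewrite ge_min lexx orbT.
by apply/andP; split; nra.
Qed.

Lemma fM_le y B : 0 <= y -> 0 <= B -> fM mu y B <= m1 * y + B.
Proof.
move=> y0 B0; rewrite fM.unlock -Ex_linear//.
apply: le_Ex => //; [by adm..|] => x x0.
by apply: tanh_le; exact: affine_ge0.
Qed.

(** The quadratic estimate of 1 - dtanh (x y) would cost a third moment; tanh^2 <= tanh <= x y costs
    only the second. *)
Lemma fP_ge y : 0 <= y -> m1 - y * m2 <= fP mu y 0.
Proof.
move=> y0; rewrite fP.unlock mean.unlock meansq.unlock -ExZ//; last by adm.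
rewrite -ExB//; [|by adm..].
apply: le_Ex => //; [by adm..|] => x x0; rewrite addr0.
have xy : 0 <= x * y by exact: mulr_ge0.
have h1 := tanh_le xy; have h2 := tanh_ge0 xy; have h3 := tanh_lt1 (x * y).
have : 1 - x * y <= dtanh (x * y).
  by have -> : dtanh (x * y) = 1 - tanh (x * y) ^+ 2 by []; nra.
move=> /(ler_wpM2r x0); lra.
Qed.

End GapEstimates.

(** * Power-law tails *)

HB.lock Definition tailp {R : realType} (mu : probability R R) (t : R) : R :=
  Ex mu (fun x => indgt t x).

HB.lock Definition tailm {R : realType} (mu : probability R R) (t : R) : R :=
  Ex mu (fun x => x ^+ 2 * indgt t x).

Section PowerTail.
Context {R : realType} (mu : probability R R).
Hypothesis mu_sqr : (\int[mu]_x (x ^+ 2)%:E < +oo)%E.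
Implicit Types y t : R.
Local Notation E := (Ex mu).
Local Notation m2 := (meansq mu).
Local Notation G := (gG mu).
Local Notation L := (gL mu).
Local Notation tailp := (tailp mu).
Local Notation tailm := (tailm mu).

Lemma invr_powR y p : 0 < y -> y^-1 `^ p = (y `^ p)^-1.
Proof.
move=> y0; have y1 : 0 <= y^-1 by rewrite invr_ge0 ltW.
have yp : y `^ p != 0 by rewrite gt_eqF// powR_gt0.
apply: (mulIf yp); rewrite (mulVf yp) -powRM ?(ltW y0)//.
by rewrite mulVf ?powR1// gt_eqF.
Qed.

Lemma powRDp y p q : 0 < y -> y `^ (p + q) = y `^ p * y `^ q.
Proof. by move=> y0; rewrite powRD// (gt_eqF y0) implybT. Qed.

Lemma ltr_powR2 (p q : R) : p < q -> 2 `^ p < 2 `^ q :> R.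
Proof.
move=> pq; have l2 : 0 < ln 2 :> R by rewrite ln_gt0// ltr1n.
by rewrite /powR gt_eqF// ltr_expR ltr_pM2r.
Qed.

Lemma tailm_step t : 0 < t -> tailm t <= 4 * t ^+ 2 * tailp t + tailm (2 * t).
Proof.
move=> t0; rewrite tailm.unlock tailp.unlock -ExZ//; last by adm.
rewrite -ExD//; [|by adm..].
apply: le_Ex => //; [by adm..|] => x x0.
rewrite /indgt; case: ltP => h1; case: ltP => h2; nra.
Qed.

Lemma tailm_small e : 0 < e -> exists2 A, 0 < A & forall t, A <= t -> tailm t <= e.
Proof.
move=> e0; have [d d0 hd] := omega_small mu_sqr e0.
exists d^-1; first by rewrite invr_gt0.
move=> t dt; have t0 : 0 < t by rewrite (lt_le_trans _ dt)// invr_gt0.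
have it0 : 0 <= t^-1 by rewrite invr_ge0 ltW.
apply: le_trans hd; apply: le_trans (_ : omega mu t^-1 <= _); last first.
  by apply: omega_mono => //; rewrite -(invrK d) lef_pV2 ?posrE ?invr_gt0.
rewrite tailm.unlock omega.unlock.
apply: le_Ex => //; [by adm..|] => x x0.
rewrite ler_wpM2l ?sqr_ge0// /indgt; case: ltP => h.
  by rewrite le_min lexx andbT ler_pdivlMr// mul1r ltW.
by rewrite min1_ge0// mulr_ge0.
Qed.

Lemma pow2_ge_nat n : n%:R <= 2 ^+ n :> R.
Proof. by rewrite -natrX ler_nat ltnW// ltn_expl. Qed.

(* K solves 4 C + K 2^-p = K, which makes tailm t - K t^-p grow along t, 2t, 4t, ...;
   its limit there is at most 0. *)
Lemma tailm_le (p C w0 : R) : 0 < p -> 0 <= C -> 0 < w0 ->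
  (forall t, w0 < t -> tailp t <= C * t `^ (- (p + 2))) ->
  exists2 K, 0 <= K & forall t, w0 < t -> tailm t <= K * t `^ (- p).
Proof.
move=> p0 C0 w00 H.
pose q : R := 2 `^ (- p).
have q0 : 0 < q by rewrite powR_gt0.
have q1 : q < 1.
  rewrite /q powRN invf_lt1 ?powR_gt0// -[X in X < _](powRr0 2).
  exact: ltr_powR2.
pose K := 4 * C / (1 - q).
have K0 : 0 <= K by rewrite divr_ge0 ?mulr_ge0// subr_ge0 ltW.
have eK : 4 * C + K * q = K by rewrite /K; field; rewrite gt_eqF// subr_gt0.
exists K => // t w0t.
pose f t := tailm t - K * t `^ (- p).
have step u : w0 < u -> f u <= f (2 * u).
  move=> w0u; have u0 : 0 < u by exact: lt_trans w0u.
  have h1 := tailm_step u0; have h2 := H _ w0u.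
  have h3 : 4 * u ^+ 2 * tailp u <= 4 * C * u `^ (- p).
    have -> : 4 * C * u `^ (- p) = 4 * u ^+ 2 * (C * u `^ (- (p + 2))).
      have -> : u `^ (- p) = u ^+ 2 * u `^ (- (p + 2)).
        rewrite -powR_mulrn ?(ltW u0)// -powRDp//.
        by congr powR; ring.
      ring.
    by rewrite ler_wpM2l// mulr_ge0// sqr_ge0.
  rewrite /f powRM ?(ltW u0)// -/q.
  have : (4 * C + K * q) * u `^ (- p) = K * u `^ (- p) by rewrite eK.
  lra.
have t0 : 0 < t by exact: lt_trans w0t.
have fn n : f t <= f (2 ^+ n * t).
  elim: n => [|n IH]; first by rewrite expr0 mul1r.
  apply: le_trans IH _; rewrite exprS -mulrA; apply: step.
  apply: lt_le_trans w0t _; rewrite ler_peMl//; first exact: ltW.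
  by rewrite exprn_ege1// ler1n.
rewrite -subr_le0 -/(f t); apply/ler_addgt0Pr => e e0; rewrite add0r.
have [A A0 hA] := tailm_small e0.
pose n := (Num.truncn (A / t)).+1.
have An : A <= 2 ^+ n * t.
  rewrite -ler_pdivrMr//; apply: le_trans (pow2_ge_nat n).
  by rewrite ltW// truncnS_gt.
apply: le_trans (fn n) _; apply: le_trans (hA _ An).
by rewrite /f lerBlDr lerDl mulr_ge0// powR_ge0.
Qed.

(** Split at x y = 1/2. Below, neither truncation is active and doubling y multiplies the integrand
    by exactly 4; above, the integrand is at most x^2. *)
Lemma gG_step y : 0 < y -> G y <= G (2 * y) / 4 + tailm (2 * y)^-1.
Proof.
move=> y0; have y0' := ltW y0; have y2 : 0 <= 2 * y by rewrite mulr_ge0.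
rewrite mulrC gG.unlock tailm.unlock -ExZ//; last by adm.
rewrite -ExD//; [|by adm..].
apply: le_Ex => //; [by adm..|] => x x0.
have xy : 0 <= x * y by exact: mulr_ge0.
have -> : 4^-1 * (x ^+ 2 * Num.min ((x * (2 * y)) ^+ 2) 1) +
   x ^+ 2 * indgt (2 * y)^-1 x =
   x ^+ 2 * (Num.min ((x * (2 * y)) ^+ 2) 1 / 4 + indgt (2 * y)^-1 x) by ring.
rewrite ler_wpM2l ?sqr_ge0// /indgt mulrCA (exprMn _ 2).
have s0 := sqr_ge0 (x * y).
case: ltP => h.
  have : Num.min ((x * y) ^+ 2) 1 <= 1 by rewrite ge_min lexx orbT.
  have : 0 <= Num.min (2 ^+ 2 * (x * y) ^+ 2) 1 by rewrite min1_ge0// mulr_ge0.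
  lra.
have h' : x * y <= 2^-1.
  move: h; rewrite -[(2 * y)^-1]mul1r ler_pdivlMr ?mulr_gt0//; lra.
have h2 : (x * y) ^+ 2 <= 4^-1 by nra.
by rewrite !min_l; lra.
Qed.

(** Split at x y = 1. Below, doubling y gains at most a factor 4; above, both minima equal 1, and
    the remaining 3/4 x^2 is at least 3/4 y^-2. *)
Lemma gG_step_ge y : 0 < y ->
  G (2 * y) / 4 + 3 / 4 * y ^- 2 * tailp y^-1 <= G y.
Proof.
move=> y0; have y0' := ltW y0; have y2 : 0 <= 2 * y by rewrite mulr_ge0.
rewrite mulrC gG.unlock tailp.unlock -!ExZ//; [|by adm..].
rewrite -ExD//; [|by adm..].
apply: le_Ex => //; [by adm..|] => x x0.
have xy : 0 <= x * y by exact: mulr_ge0.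
have -> : (x * (2 * y)) ^+ 2 = 2 ^+ 2 * (x * y) ^+ 2 by ring.
rewrite /indgt.
have s0 := sqr_ge0 (x * y); have x2 := sqr_ge0 x.
case: ltP => h.
  have h' : 1 < x * y by move: h; rewrite -[y^-1]mul1r ltr_pdivrMr.
  have h2 : 1 <= (x * y) ^+ 2 by rewrite expr_ge1// ltW.
  rewrite !min_r//; last lra.
  have : y ^- 2 <= x ^+ 2.
    by rewrite -[y ^- 2]mul1r ler_pdivrMr ?exprn_gt0// -exprMn.
  lra.
rewrite mulr0 addr0.
have : Num.min (2 ^+ 2 * (x * y) ^+ 2) 1 <= 4 * Num.min ((x * y) ^+ 2) 1.
  by have [?|?] := leP ((x * y) ^+ 2) 1; have [?|?] := leP (2 ^+ 2 * (x * y) ^+ 2) 1; lra.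
move: (Num.min _ _) => m; move: (Num.min _ _) => m'; nra.
Qed.

(** Finitely many doublings bring any y in ]0, y1[ into the base interval [y1, 2 y1[. *)
Lemma dyadic_ind (P : R -> Prop) y1 : 0 < y1 ->
  (forall y, y1 <= y -> y < 2 * y1 -> P y) ->
  (forall y, 0 < y -> y < y1 -> P (2 * y) -> P y) ->
  forall y, 0 < y -> y < 2 * y1 -> P y.
Proof.
move=> y10 H0 H1.
have H n y : 0 < y -> y < 2 * y1 -> y1 <= 2 ^+ n * y -> P y.
  elim: n y => [|n IH] y y0 yy1 h; first by apply: H0 => //; rewrite -[y]mul1r.
  have [yle|/H0] := ltP y y1; last exact.
  apply: H1 => //; apply: IH; [by rewrite mulr_gt0|by rewrite ltr_pM2l|].
  by rewrite mulrA -exprSr.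
move=> y y0 yy1; apply: (H (Num.truncn (y1 / y)).+1) => //.
rewrite -ler_pdivrMr//; apply: le_trans (pow2_ge_nat _).
by rewrite ltW// truncnS_gt.
Qed.

(** One step of [gG_step] sends a bound K y^p to (K 2^p / 4 + K0 2^p) y^p. As p < 2, the factor 2^p
    / 4 is below 1 and a large K reproduces itself. *)
Lemma gG_le_powR (p C w0 : R) : 0 < p -> p < 2 -> 0 <= C -> 0 < w0 ->
  (forall t, w0 < t -> tailp t <= C * t `^ (- (p + 2))) ->
  exists K d : R, [/\ 0 < K, 0 < d & forall y, 0 < y -> y < d -> G y <= K * y `^ p].
Proof.
move=> p0 p2 C0 w00 /(tailm_le p0 C0 w00) [K0 K00 HK].
pose y1 := (4 * w0)^-1; have y10 : 0 < y1 by rewrite invr_gt0 mulr_gt0.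
pose q : R := 2 `^ p.
have q0 : 0 < q by rewrite powR_gt0.
have q4 : q < 4.
  have -> : 4 = 2 `^ 2 :> R by rewrite powR_mulrn//; ring.
  exact: ltr_powR2.
have m20 := meansq_ge0 mu.
have Y0 : 0 < y1 `^ p by rewrite powR_gt0.
(* The first term absorbs the recursion, the second covers the base interval, the third ensures
   positivity. *)
pose K := K0 * q / (1 - q / 4) + m2 / y1 `^ p + 1.
have q4' : 0 < 1 - q / 4 by lra.
have K1 : 0 <= K0 * q / (1 - q / 4) by rewrite divr_ge0 ?mulr_ge0// ltW.
have K2 : 0 <= m2 / y1 `^ p by rewrite divr_ge0// ltW.
have Kpos : 0 < K by rewrite /K; lra.
exists K, (2 * y1); split => //; first by rewrite mulr_gt0.
apply: dyadic_ind => // y.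
  move=> yy1 _; have y0 : 0 < y by exact: lt_le_trans yy1.
  apply: le_trans (gG_le mu_sqr (ltW y0)) _.
  have : m2 <= K * y1 `^ p by rewrite -ler_pdivrMr// /K; lra.
  move=> /le_trans; apply; rewrite ler_wpM2l ?(ltW Kpos)//.
  by apply: ge0_ler_powR => //; rewrite ?nnegrE ltW.
move=> y0 yy1 IH; apply: le_trans (gG_step y0) _.
have hw : w0 < (2 * y)^-1.
  rewrite -(invrK w0) ltf_pV2 ?posrE ?invr_gt0 ?mulr_gt0//.
  have : 4 * y < w0^-1.
    by rewrite mulrC -ltr_pdivlMr// -invfM mulrC.
  lra.
have := HK _ hw; rewrite invr_powR ?mulr_gt0// powRN invrK.
move: IH; rewrite powRM ?(ltW y0)// -/q => h1 h2.
have e1 : K0 * q <= K * (1 - q / 4).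
  by rewrite -ler_pdivrMr// /K; lra.
have := ler_wpM2r (powR_ge0 y p) e1; lra.
Qed.

(** The weights above 1/y suffice: there the minimum equals 1 and x > 1/y. *)
Lemma gL_ge_powR (p c w0 : R) : 0 < w0 ->
  (forall t, w0 < t -> c * t `^ (- (p + 2)) <= tailp t) ->
  forall y, 0 < y -> y < w0^-1 -> c * (y * y `^ p) <= L y.
Proof.
move=> w00 H y y0 yw; have y0' := ltW y0.
have hw : w0 < y^-1 by rewrite -(invrK w0) ltf_pV2 ?posrE ?invr_gt0.
have := H _ hw; rewrite invr_powR// powRN invrK => h.
apply: le_trans (_ : y^-1 * tailp y^-1 <= _).
  have -> : c * (y * y `^ p) = y^-1 * (c * y `^ (p + 2)).
    rewrite powRDp//.
    by rewrite powR_mulrn//; field; rewrite gt_eqF.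
  by rewrite ler_wpM2l// invr_ge0.
rewrite tailp.unlock gL.unlock -ExZ//; last by adm.
apply: le_Ex => //; [by adm..|] => x x0; rewrite /indgt.
have xy : 0 <= x * y by exact: mulr_ge0.
case: ltP => hx; last by rewrite mulr0 mulr_ge0// min1_ge0// exprn_ge0.
have h' : 1 < x * y by move: hx; rewrite -[y^-1]mul1r ltr_pdivrMr.
rewrite min_r; last by rewrite expr_ge1// ltW.
by rewrite !mulr1 ltW.
Qed.

(** Resonant case 2^p / 4 = 1: each halving of y adds 4 K0 to the bound on G(y) / y^2, and b ln 2 =
    4 K0 books this increment in the logarithm. *)
Lemma gG_le_log (C w0 : R) : 0 <= C -> 1 < w0 ->
  (forall t, w0 < t -> tailp t <= C * t `^ (- (2 + 2))) ->
  exists K d : R, [/\ 0 < K, 0 < d &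
    forall y, 0 < y -> y < d -> G y <= K * (y ^+ 2 * ln y^-1)].
Proof.
move=> C0 w01; have w00 : 0 < w0 by lra.
move=> /(@tailm_le 2 C w0 (ltr0Sn _ _) C0 w00) [K0 K00 HK].
pose y1 := (4 * w0)^-1; have y10 : 0 < y1 by rewrite invr_gt0 mulr_gt0.
have y14 : 4 * y1 < 1.
  by rewrite /y1 mulrC ltr_pdivrMl ?mulr_gt0//; lra.
have m20 := meansq_ge0 mu.
have l2 : 0 < ln 2 :> R by rewrite ln_gt0// ltr1n.
pose b := 4 * K0 / ln 2; have b0 : 0 <= b by rewrite divr_ge0 ?mulr_ge0// ltW.
pose A := m2 / y1 ^+ 2; have A0 : 0 <= A by rewrite divr_ge0// sqr_ge0.
have H : forall y, 0 < y -> y < 2 * y1 -> G y <= y ^+ 2 * (A + b * ln y^-1).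
  apply: dyadic_ind => // y.
    move=> yy1 y1y; have y0 : 0 < y by exact: lt_le_trans yy1.
    apply: le_trans (gG_le mu_sqr (ltW y0)) _.
    have -> : m2 = y1 ^+ 2 * A by rewrite /A mulrC divfK// gt_eqF// exprn_gt0.
    have l0 : 0 <= ln y^-1.
      by rewrite ln_ge0// invf_ge1//; lra.
    rewrite ler_pM ?sqr_ge0//; first by rewrite lerXn2r ?nnegrE// ltW.
    by rewrite lerDl mulr_ge0.
  move=> y0 yy1 IH; apply: le_trans (gG_step y0) _.
  have hw : w0 < (2 * y)^-1.
    rewrite -(invrK w0) ltf_pV2 ?posrE ?invr_gt0 ?mulr_gt0//.
    have : 4 * y < w0^-1.
      by rewrite mulrC -ltr_pdivlMr// -invfM mulrC.
    lra.
  have := HK _ hw; rewrite invr_powR ?mulr_gt0// powRN invrK.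
  rewrite powR_mulrn ?mulr_ge0 ?(ltW y0)//.
  move: IH; rewrite invfM lnM ?posrE ?invr_gt0// [ln 2^-1]lnV ?posrE// exprMn.
  have : b * ln 2 = 4 * K0 by rewrite /b divfK// gt_eqF.
  move: (ln y^-1) (ln 2) => l l' e h1 h2.
  have : y ^+ 2 * (b * l') = y ^+ 2 * (4 * K0) by rewrite e.
  lra.
(* Below exp(-1) the logarithm is at least 1 and absorbs the constant [A]. *)
pose d : R := Num.min (2 * y1) (expR (-1)).
have d0 : 0 < d by rewrite lt_min mulr_gt0 ?expR_gt0.
exists (A + b + 1), d; split => //; first lra.
move=> y y0; rewrite lt_min => /andP[yd ye].
apply: le_trans (H y y0 yd) _; rewrite mulrCA ler_wpM2l ?sqr_ge0//.
have : 1 <= ln y^-1.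
  rewrite lnV ?posrE// lerNr -[leRHS]expRK ler_ln ?posrE ?expR_gt0//.
  exact: ltW.
nra.
Qed.

(** Each halving adds at least 3 c / 4 to G(y) / y^2. The logarithm is shifted by ln (1/y1), so that
    the claim on the base interval is only G >= 0. *)
Lemma gG_ge_log (c w0 : R) : 0 < c -> 1 < w0 ->
  (forall t, w0 < t -> c * t `^ (- (2 + 2)) <= tailp t) ->
  exists k d : R, [/\ 0 < k, 0 < d &
    forall y, 0 < y -> y < d -> k * (y ^+ 2 * ln y^-1) <= G y].
Proof.
move=> c0 w01 Ht; have w00 : 0 < w0 by lra.
pose y1 := (4 * w0)^-1; have y10 : 0 < y1 by rewrite invr_gt0 mulr_gt0.
have w4 : 0 < 4 * w0 by lra.
have y11 : y1 < 1 by rewrite invf_lt1//; lra.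
have l2 : 0 < ln 2 :> R by rewrite ln_gt0// ltr1n.
pose b := 3 / 4 * c / ln 2; have b0 : 0 < b by rewrite divr_gt0// mulr_gt0.
have G0 y : 0 <= G y.
  rewrite gG.unlock; apply: Ex_ge0 => x x0.
  by rewrite mulr_ge0 ?sqr_ge0// min1_ge0// sqr_ge0.
have H : forall y, 0 < y -> y < 2 * y1 ->
    b * (y ^+ 2 * (ln y^-1 - ln y1^-1)) <= G y.
  apply: dyadic_ind => // y.
    move=> yy1 y1y; have y0 : 0 < y by exact: lt_le_trans yy1.
    apply: le_trans (G0 y); rewrite mulr_ge0_le0 ?(ltW b0)//.
    rewrite mulr_ge0_le0 ?sqr_ge0// subr_le0 ler_ln ?posrE ?invr_gt0//.
    by rewrite lef_pV2.
  move=> y0 yy1 IH; apply: le_trans (gG_step_ge y0).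
  have hw : w0 < y^-1.
    rewrite -(invrK w0) ltf_pV2 ?posrE ?invr_gt0//; apply: lt_trans yy1 _.
    by rewrite ltf_pV2 ?posrE//; lra.
  have := Ht _ hw; rewrite invr_powR// powRN invrK.
  have -> : (2 + 2 : R) = 4%:R by ring.
  rewrite powR_mulrn ?(ltW y0)// => h.
  have {}h : 3 / 4 * c * y ^+ 2 <= 3 / 4 * y ^- 2 * tailp y^-1.
    have -> : 3 / 4 * c * y ^+ 2 = 3 / 4 * y ^- 2 * (c * y ^+ 4).
      by field; rewrite gt_eqF.
    by rewrite ler_wpM2l// mulr_ge0// invr_ge0 sqr_ge0.
  move: IH h; rewrite invfM lnM ?posrE ?invr_gt0// [ln 2^-1]lnV ?posrE// exprMn.
  have : b * ln 2 = 3 / 4 * c by rewrite /b divfK// gt_eqF.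
  move: (ln y^-1) (ln 2) (ln y1^-1) (y ^- 2) => l l' l'' iy e h1 h2.
  have : y ^+ 2 * (b * l') = y ^+ 2 * (3 / 4 * c) by rewrite e.
  lra.
have d0 : 0 < y1 ^+ 2 by rewrite exprn_gt0.
(* For y < y1^2 the shift is at most half of ln (1/y), whence b / 2. *)
exists (b / 2), (y1 ^+ 2); split => //; first by rewrite divr_gt0.
move=> y y0 yd.
have yd' : y < 2 * y1 by apply: lt_trans yd _; nra.
apply: le_trans (H y y0 yd'); rewrite -mulrA ler_wpM2l ?(ltW b0)//.
rewrite mulrCA ler_wpM2l ?sqr_ge0//.
have e1 : ln y1^-1 = - ln y1 by rewrite lnV ?posrE.
have e2 : ln y^-1 = - ln y by rewrite lnV ?posrE.
have : ln y <= ln y1 *+ 2 by rewrite -lnXn// ler_ln ?posrE// ltW.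
rewrite e1 e2; lra.
Qed.

End PowerTail.

(** * Asymptotics near the critical point *)

Section Comparison.
Context {R : realType}.
Implicit Types (f g h u : R -> R).

(** Stated without division, so that symmetry, transitivity and substitution of a [tends0] function
    require no positivity of [h]. *)
Definition cmp f h : Prop := exists c C d : R, [/\ 0 < c, 0 < C, 0 < d &
  forall t, 0 < t -> t < d -> c * h t <= f t <= C * h t].

(** Positivity is included because [cmp] speaks of positive arguments only. *)
Definition tends0 u : Prop := forall e, 0 < e -> exists2 d, 0 < d &
  forall t, 0 < t -> t < d -> 0 < u t /\ u t < e.

Lemma cmp_trans f g h : cmp f g -> cmp g h -> cmp f h.
Proof.
move=> [c [C [d [c0 C0 d0 H]]]] [c' [C' [d' [c'0 C'0 d'0 H']]]].
exists (c * c'), (C * C'), (Num.min d d'); split.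
- exact: mulr_gt0.
- exact: mulr_gt0.
- by rewrite lt_min d0.
move=> t t0; rewrite lt_min => /andP[td td'].
have /andP[h1 h2] := H t t0 td; have /andP[h3 h4] := H' t t0 td'.
rewrite -!mulrA; apply/andP; split.
  by apply: le_trans h1; rewrite ler_wpM2l// ltW.
by apply: le_trans h2 _; rewrite ler_wpM2l// ltW.
Qed.

Lemma cmp_sym f g : cmp f g -> cmp g f.
Proof.
move=> [c [C [d [c0 C0 d0 H]]]]; exists C^-1, c^-1, d.
split => //; rewrite ?invr_gt0// => t t0 td; have /andP[h1 h2] := H t t0 td.
by rewrite [C^-1 * _]mulrC [c^-1 * _]mulrC ler_pdivrMr// ler_pdivlMr// mulrC h2 mulrC h1.
Qed.

Lemma cmp_comp f g u : tends0 u -> cmp f g ->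
  cmp (fun t => f (u t)) (fun t => g (u t)).
Proof.
move=> hu [c [C [d [c0 C0 d0 H]]]]; have [d' d'0 hd'] := hu _ d0.
exists c, C, d'; split => // t t0 td.
by have [u0 ud] := hd' t t0 td; exact: H.
Qed.

Lemma eq_cmp f g f' g' d : 0 < d ->
  (forall t, 0 < t -> t < d -> f t = f' t) ->
  (forall t, 0 < t -> t < d -> g t = g' t) -> cmp f g -> cmp f' g'.
Proof.
move=> d0 ef eg [c [C [d' [c0 C0 d'0 H]]]].
exists c, C, (Num.min d d'); split => //; first by rewrite lt_min d0.
move=> t t0; rewrite lt_min => /andP[td td'].
by rewrite -ef// -eg//; exact: H.
Qed.

Lemma cmp_powR r f g : 0 < r ->
  (forall t, 0 < t -> t < 1 -> 0 <= g t) -> cmp f g ->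
  cmp (fun t => f t `^ r) (fun t => g t `^ r).
Proof.
move=> r0 g0 [c [C [d [c0 C0 d0 H]]]].
exists (c `^ r), (C `^ r), (Num.min 1 d); split; rewrite ?powR_gt0//.
  by rewrite lt_min ltr01.
move=> t t0; rewrite lt_min => /andP[t1 td].
have /andP[h1 h2] := H t t0 td; have gt := g0 t t0 t1.
have cg : 0 <= c * g t by rewrite mulr_ge0// ltW.
rewrite -!powRM ?(ltW c0) ?(ltW C0)//.
have f0 : 0 <= f t by exact: le_trans h1.
have Cg : 0 <= C * g t by exact: le_trans h2.
by apply/andP; split; apply: ge0_ler_powR => //; exact: ltW.
Qed.

(** Asymptotic inversion: H(u(t)) of order t with H(y) of order y^q determines the order of u. *)
Lemma cmp_inv_powR (H : R -> R) (q : R) u : 0 < q -> tends0 u ->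
  cmp H (fun y => y `^ q) -> cmp (fun t => H (u t)) id ->
  cmp u (fun t => t `^ q^-1).
Proof.
move=> q0 hu /(cmp_comp hu)/cmp_sym h1 h2.
have q0' : 0 < q^-1 by rewrite invr_gt0.
have h3 : cmp (fun t => (u t `^ q) `^ q^-1) (fun t => t `^ q^-1).
  by apply: cmp_powR (cmp_trans h1 h2) => // t /ltW.
have [d d0 hd] := hu 1 ltr01.
apply: (eq_cmp d0) h3 => // t t0 td; have [u0 _] := hd t t0 td.
by rewrite -powRrM divff ?gt_eqF// powRr1// ltW.
Qed.

Lemma ln_div_ge0 (t : R) : 0 < t -> t < 1 -> 0 <= t / ln t^-1.
Proof.
move=> t0 t1; rewrite divr_ge0 ?(ltW t0)// ln_ge0// ltW//.
by rewrite -(invr1 R) ltf_pV2 ?posrE.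
Qed.

Lemma tends0_ln u : tends0 u -> forall A, exists2 d, 0 < d &
  forall t, 0 < t -> t < d -> 0 < u t /\ A <= ln (u t)^-1.
Proof.
move=> hu A; have [d d0 hd] := hu _ (expR_gt0 (- A)).
exists d => // t t0 td; have [u0 ue] := hd t t0 td; split => //.
rewrite lnV ?posrE// lerNr -[leRHS]expRK ler_ln ?posrE ?expR_gt0//.
exact: ltW.
Qed.

(** It suffices that ln (1/u) and ln (1/t) are comparable. The exponent is at least 2 because one
    factor u cancels the logarithm and another must remain to compare t with u. *)
Lemma cmp_inv_log n u : tends0 u ->
  cmp (fun t => u t ^+ n.+2 * ln (u t)^-1) id ->
  cmp (fun t => u t ^+ n.+2) (fun t => t / ln t^-1).
Proof.
move=> hu [a [b [d [a0 b0 d0 H]]]].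
(* Once ln (1/u) exceeds [A], the additive errors ln a and ln b are absorbed, at the price of the
   factors 1/2 and n + 3. *)
pose A := 1 + 2 * `|ln a| + `|ln b|.
have [d' d'0 hd'] := tends0_ln hu A.
exists (a / 2), (b * n.+3%:R), (Num.min d d').
split; rewrite ?divr_gt0 ?mulr_gt0// ?lt_min ?d0//.
move=> t t0; rewrite lt_min => /andP[td td'].
have /andP[h1 h2] := H t t0 td; have [u0 hl] := hd' t t0 td'.
set v := u t in h1 h2 u0 hl *; set l := ln v^-1 in h1 h2 hl.
set lam := ln t^-1.
have nA := normr_ge0 (ln a); have nB := normr_ge0 (ln b).
have nA' := ler_norm (- ln a); rewrite normrN in nA'.
have nB' := ler_norm (ln b).
have l1 : 1 <= l by rewrite /A in hl; lra.
have iv0 : 0 < v^-1 by rewrite invr_gt0.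
have v1 : v <= 1.
  rewrite -(invrK v) invf_le1 ?invr_gt0// -ler_ln ?posrE// ln1 -/l; lra.
have vn0 : 0 < v ^+ n.+2 by rewrite exprn_gt0.
(* From v l <= 1 and v <= 1 one gets a t <= v^(n+2) l <= v; then take logarithms. *)
have lam1 : l / 2 <= lam.
  have : a * t <= v.
    apply: le_trans h1 _; rewrite exprS exprS -mulrA ler_piMr ?(ltW u0)//.
    have vl : v * l <= 1.
      have := ln_sublinear iv0; rewrite -/l => /ltW /(ler_wpM2l (ltW u0)).
      by rewrite mulfV ?gt_eqF.
    rewrite mulrAC; apply: mulr_ile1 => //; rewrite ?mulr_ge0 ?exprn_ge0 ?(ltW u0)//.
      lra.
    by rewrite exprn_ile1// ltW.
  rewrite -ler_ln ?posrE ?mulr_gt0// lnM ?posrE//.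
  rewrite /lam /l !lnV ?posrE//; rewrite /l lnV ?posrE// /A in hl; lra.
have lam2 : lam <= n.+3%:R * l.
  have : v ^+ n.+2 <= b * t.
    by apply: le_trans h2; rewrite ler_peMr// ltW.
  have bt0 : 0 < b * t by exact: mulr_gt0.
  rewrite -ler_ln ?posrE// lnM ?posrE// lnXn//.
  have -> : n.+3%:R * l = l + n.+2%:R * l by rewrite -[n.+3%:R]natr1; ring.
  rewrite /lam /l !lnV ?posrE// -mulr_natl.
  rewrite /l lnV ?posrE// /A in hl; lra.
have l0 : 0 < l by lra.
have lam0 : 0 < lam by lra.
rewrite !mulrA; apply/andP; split.
  rewrite ler_pdivrMr//.
  have := ler_wpM2l (ltW vn0) lam1; lra.
rewrite ler_pdivlMr//; apply: le_trans (ler_wpM2l (ltW vn0) lam2) _.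
have n3 : 0 <= n.+3%:R :> R by [].
have := ler_wpM2l n3 h2; lra.
Qed.

Lemma cmp_inv_powR_log (H : R -> R) n u : tends0 u ->
  cmp H (fun y => y ^+ n.+2 * ln y^-1) -> cmp (fun t => H (u t)) id ->
  cmp u (fun t => (t / ln t^-1) `^ n.+2%:R^-1).
Proof.
move=> hu /(cmp_comp hu)/cmp_sym h1 h2.
have /cmp_inv_log := cmp_trans h1 h2; move=> /(_ hu) h3.
have q0' : 0 < n.+2%:R^-1 :> R by rewrite invr_gt0.
have {}h3 := cmp_powR q0' ln_div_ge0 h3.
have [d d0 hd] := hu 1 ltr01.
apply: (eq_cmp d0) h3 => // t t0 td; have [u0 _] := hd t t0 td.
by rewrite -powR_mulrn ?(ltW u0)// -powRrM divff ?powRr1 ?(ltW u0)// pnatr_eq0.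
Qed.

End Comparison.

(** * The solution, D and the susceptibility near the critical value of s *)

Section Asymptotics.
Context {R : realType} (mu : probability R R).
Hypothesis mu_sqr : (\int[mu]_x (x ^+ 2)%:E < +oo)%E.
Hypothesis mean_gt0 : 0 < mean mu.
Implicit Types y B s t : R.
Local Notation m1 := (mean mu).
Local Notation m2 := (meansq mu).
Local Notation G := (gG mu).
Local Notation L := (gL mu).
Local Notation y0 := (y0 mu).

Lemma meansq_gt0 : 0 < m2.
Proof.
by apply: lt_le_trans (gG_le mu_sqr ler01); exact: (gG_gt0 mu_sqr mean_gt0 ltr01).
Qed.

Definition sc : R := m2^-1.

Lemma sc_gt0 : 0 < sc.
Proof. by rewrite invr_gt0 meansq_gt0. Qed.

Lemma sc_mul : sc * m2 = 1.
Proof. by rewrite mulVf// gt_eqF// meansq_gt0. Qed.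

Lemma y0_nonneg s : 0 < s -> 0 <= y0 s.
Proof. exact: (y0_ge0 mu_sqr mean_gt0). Qed.

Lemma fF_y0 s : 0 < s -> fF mu (y0 s) 0 = y0 s / s.
Proof.
move=> s0; rewrite {2}(y0_fix mu_sqr mean_gt0 s0) mulrC mulrA mulVf ?mul1r//.
by rewrite gt_eqF.
Qed.

(** With r = m2 - 1/s > 0 the fixed-point equation forces r <= G(ystar) at every field, whereas G <=
    r/2 on [0, d]; hence all the solutions stay above d. *)
Lemma y0_gt0 s : 0 < s -> 1 < s * m2 -> 0 < y0 s.
Proof.
move=> s0 sm; have is0 : 0 < s^-1 by rewrite invr_gt0.
pose r := m2 - s^-1.
have r0 : 0 < r by rewrite subr_gt0 -[s^-1]mul1r ltr_pdivrMr// mulrC.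
have [|d d0 hd] := @omega_small R mu mu_sqr (r / 2); first lra.
apply: lt_le_trans d0 _; apply: (y0_ge mu_sqr mean_gt0 s0) => B B0.
have Y0 := ystar_gt0 mu_sqr mean_gt0 s0 B0.
have eY := ystar_fix mu_sqr mean_gt0 s0 B0.
set Y := ystar mu s B in Y0 eY *.
rewrite leNgt; apply/negP => Yd.
have h1 := gap_le0 mu_sqr (ltW Y0) (ltW B0).
have eF : fF mu Y B = Y / s.
  by rewrite {2}eY mulrC mulrA mulVf ?mul1r// gt_eqF.
have h2 : r <= G Y by rewrite -(ler_pM2l Y0) /r mulrBr -eF.
have h3 := gG_le_omega mu_sqr (ltW Y0).
have h4 := omega_mono mu_sqr (ltW Y0) (ltW Yd).
lra.
Qed.

Lemma y0_rate s : 0 < s -> 0 < y0 s ->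
  gapc * G (y0 s) <= m2 - s^-1 <= G (y0 s).
Proof.
move=> s0 Y0; have h1 := gap_le0 mu_sqr (ltW Y0) (lexx 0).
have h2 := gap_ge mu_sqr (ltW Y0) (lexx 0).
rewrite mul0r addr0 in h2; rewrite !fF_y0// in h1 h2.
by apply/andP; split; rewrite -(ler_pM2l Y0) mulrBr// mulrCA.
Qed.

Lemma y0_eq0 s : 0 < s -> s * m2 < 1 -> y0 s = 0.
Proof.
move=> s0 sm; apply/eqP; apply: contraT => Y0.
have {}Y0 : 0 < y0 s by rewrite lt_neqAle eq_sym Y0 y0_nonneg.
have /andP[h _] := y0_rate s0 Y0.
have h1 := mulr_gt0 (gapc_gt0 (R:=R)) (gG_gt0 mu_sqr mean_gt0 Y0).
have : m2 - s^-1 < 0 by rewrite subr_lt0 -[s^-1]mul1r ltr_pdivlMr// mulrC.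
lra.
Qed.

Lemma super_gt s : sc < s -> 0 < s /\ 1 < s * m2.
Proof.
move=> h; split; first exact: lt_trans sc_gt0 h.
by rewrite -sc_mul ltr_pM2r// meansq_gt0.
Qed.

Lemma super_cmp t : 0 < t -> t < sc ->
  m2 ^+ 2 / 2 * t <= G (y0 (sc + t)) <= m2 ^+ 2 / gapc * t.
Proof.
move=> t0 tsc; have [|s0 sm] := @super_gt (sc + t); first lra.
have Y0 := y0_gt0 s0 sm.
have /andP[h1 h2] := y0_rate s0 Y0.
have k0 := gapc_gt0 (R:=R); have scp := sc_gt0; have e := sc_mul.
have m0 := meansq_gt0.
(* Here sc m2 = 1; the restriction t < sc keeps sc + t below 2 sc, which is the source of the factor
   1/2. *)
have er : m2 - (sc + t)^-1 = m2 * t / (sc + t).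
  have -> : m2 * t = m2 * (sc + t) - 1 by rewrite -e; ring.
  by rewrite mulrBl mulfK ?mul1r// gt_eqF.
have u1 : m2 * t / (sc + t) <= m2 ^+ 2 * t.
  rewrite ler_pdivrMr//.
  have -> : m2 ^+ 2 * t * (sc + t) = m2 * t * (sc * m2) + (m2 * t) ^+ 2 by ring.
  by rewrite e mulr1 lerDl sqr_ge0.
have u2 : m2 ^+ 2 / 2 * t <= m2 * t / (sc + t).
  rewrite ler_pdivlMr//.
  have -> : m2 ^+ 2 / 2 * t * (sc + t) = m2 * t * (m2 * (sc + t) / 2) by field.
  rewrite ler_piMr//; first by rewrite mulr_ge0// ltW.
  have : m2 * t < m2 * sc by rewrite ltr_pM2l.
  lra.
apply/andP; split; first by rewrite er in h2; exact: le_trans h2.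
rewrite mulrAC ler_pdivlMr// mulrC; rewrite er in h1; exact: le_trans u1.
Qed.

Lemma cmp_super : cmp (fun t => G (y0 (sc + t))) id.
Proof.
exists (m2 ^+ 2 / 2), (m2 ^+ 2 / gapc), sc.
have m0 := meansq_gt0; have k0 := gapc_gt0 (R:=R).
split; [by rewrite divr_gt0// exprn_gt0|by rewrite divr_gt0// exprn_gt0|exact: sc_gt0|].
exact: super_cmp.
Qed.

(** G(y0) is at most a multiple of t, and G is nondecreasing and positive off 0, so y0 >= e would
    keep G(y0) above G(e). *)
Lemma tends0_super : tends0 (fun t => y0 (sc + t)).
Proof.
move=> e e0; have Ge := gG_gt0 mu_sqr mean_gt0 e0.
have m0 := meansq_gt0; have k0 := gapc_gt0 (R:=R).
have c0 : 0 < m2 ^+ 2 / gapc by rewrite divr_gt0// exprn_gt0.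
exists (Num.min sc (G e / (m2 ^+ 2 / gapc))).
  by rewrite lt_min sc_gt0 divr_gt0.
move=> t t0; rewrite lt_min => /andP[tsc te].
have [|s0 sm] := @super_gt (sc + t); first lra.
have Y0 := y0_gt0 s0 sm; split => //.
have /andP[_ h] := super_cmp t0 tsc.
rewrite ltNge; apply/negP => /(gG_mono mu_sqr (ltW e0)) h'.
by move: te; rewrite ltr_pdivlMr// mulrC; lra.
Qed.

Lemma tends0_le1 (u : R -> R) : tends0 u -> exists2 d, 0 < d &
  forall t, 0 < t -> t < d -> 0 < u t /\ u t < 1.
Proof. by move=> /(_ 1 ltr01). Qed.

Lemma cmp_fM_super : cmp (fun t => fM mu (y0 (sc + t)) 0) (fun t => y0 (sc + t)).
Proof.
have [d d0 hd] := tends0_le1 tends0_super.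
exists (tanh1 * trmean mu), m1, d; split => //.
  by rewrite mulr_gt0 ?tanh1_gt0// trmean_gt0.
move=> t t0 td; have [u0 u1] := hd t t0 td.
rewrite fM_ge//=; [|exact: ltW..].
by have := fM_le mu_sqr (ltW u0) (lexx 0); rewrite addr0.
Qed.

(** At the critical value the fixed-point equation reads F = y m2, so the linear terms in y cancel
    in the gap and only B m1 is left. *)
Lemma crit_rate B : 0 < B ->
  gapc * (ystar mu sc B * G (ystar mu sc B)) <= B * m1 <=
  8 * (ystar mu sc B * G (ystar mu sc B)) + 8 * B ^+ 3 * m1.
Proof.
move=> B0; have s0 := sc_gt0.
have Y0 := ystar_gt0 mu_sqr mean_gt0 s0 B0.
have eY := ystar_fix mu_sqr mean_gt0 s0 B0.
set Y := ystar mu sc B in Y0 eY *.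
have eF : fF mu Y B = Y * m2.
  by rewrite {2}eY mulrAC sc_mul mul1r.
have h1 := gap_ge mu_sqr (ltW Y0) (ltW B0).
have h2 := gap_le mu_sqr (ltW Y0) (ltW B0).
by rewrite eF in h1 h2; lra.
Qed.

Lemma cmp_crit : cmp (fun B => ystar mu sc B * G (ystar mu sc B)) id.
Proof.
have k0 := gapc_gt0 (R:=R).
(* For B < 1/4 the error 8 B^3 m1 is at most half of B m1; the 16 is twice the 8 of [crit_rate]. *)
exists (m1 / 16), (m1 / gapc), 4^-1; split; [exact: divr_gt0|exact: divr_gt0|by rewrite invr_gt0|].
move=> B B0 B4.
have /andP[h1 h2] := crit_rate B0.
have b3 : 8 * B ^+ 3 * m1 <= B * m1 / 2.
  have : 16 * B ^+ 2 <= 1 by nra.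
  move=> /(ler_wpM2l (ltW (mulr_gt0 B0 mean_gt0))); lra.
apply/andP; split; first lra.
by rewrite mulrAC ler_pdivlMr// mulrC [X in _ <= X]mulrC.
Qed.

Lemma tends0_crit : tends0 (fun B => ystar mu sc B).
Proof.
move=> e e0; have Ge := gG_gt0 mu_sqr mean_gt0 e0; have k0 := gapc_gt0 (R:=R).
have c0 : 0 < gapc * (e * G e) by rewrite mulr_gt0// mulr_gt0.
exists (gapc * (e * G e) / m1); first by rewrite divr_gt0.
move=> B B0; rewrite ltr_pdivlMr// => Be.
have Y0 := ystar_gt0 mu_sqr mean_gt0 sc_gt0 B0; split => //.
rewrite ltNge; apply/negP => eY.
have /andP[h1 _] := crit_rate B0.
have : e * G e <= ystar mu sc B * G (ystar mu sc B).
  by apply: ler_pM => //; [exact: ltW|exact: ltW|apply: gG_mono => //; exact: ltW].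
rewrite -(ler_pM2l k0); lra.
Qed.

(** The direct contribution B in M <= m1 y + B is harmless: [crit_rate] and G <= m2 give B <= (16 m2
    / m1) y. *)
Lemma cmp_mag_crit : cmp (mag mu sc) (fun B => ystar mu sc B).
Proof.
have [d d0 hd] := tends0_le1 tends0_crit.
have m0 := meansq_gt0.
exists (tanh1 * trmean mu), (m1 + 16 * m2 / m1), (Num.min d 4^-1); split => //.
- by rewrite mulr_gt0 ?tanh1_gt0// trmean_gt0.
- by rewrite addr_gt0// divr_gt0// mulr_gt0.
- by rewrite lt_min d0 andTb invr_gt0 ltr0n.
move=> B B0; rewrite lt_min => /andP[Bd B4]; have [u0 u1] := hd B B0 Bd.
rewrite /mag fM_ge//=; [|exact: ltW..].
apply: le_trans (fM_le mu_sqr (ltW u0) (ltW B0)) _.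
rewrite [leRHS]mulrDl lerD2l.
have /andP[h1 h2] := crit_rate B0.
have b3 : 8 * B ^+ 3 * m1 <= B * m1 / 2.
  have : 16 * B ^+ 2 <= 1 by nra.
  move=> /(ler_wpM2l (ltW (mulr_gt0 B0 mean_gt0))); lra.
have := ler_wpM2l (ltW u0) (gG_le mu_sqr (ltW u0)) => h3.
by rewrite mulrAC ler_pdivlMr//; lra.
Qed.

Lemma fD_y0 s : 0 < s ->
  y0 s * fD mu s (y0 s) 0 = s * (fF mu (y0 s) 0 - y0 s * fQ mu (y0 s) 0).
Proof.
move=> s0; rewrite /fD mulrBr mulr1 {1}(y0_fix mu_sqr mean_gt0 s0); ring.
Qed.

(** y D lies between multiples of L and of y G; the hypothesis makes both of order y G, so D is of
    the order of G(y0), which is t. *)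
Lemma cmp_fD_super : cmp L (fun y => y * G y) ->
  cmp (fun t => fD mu (sc + t) (y0 (sc + t)) 0) id.
Proof.
move=> /(cmp_comp tends0_super)[c [C [d [c0 C0 d0 H]]]].
apply: cmp_trans cmp_super.
have scp := sc_gt0; have k0 := tanh_dgap_cst_gt0 (R:=R).
exists (sc * tanh_dgap_cst * c), (2 * sc), (Num.min d sc); split.
- by apply: mulr_gt0 => //; exact: mulr_gt0.
- by rewrite mulr_gt0.
- by rewrite lt_min d0.
move=> t t0; rewrite lt_min => /andP[td tsc].
have [|s0 sm] := @super_gt (sc + t); first lra.
have Y0 := y0_gt0 s0 sm; have /andP[hL _] := H t t0 td.
have h1 := dgap_ge mu_sqr (ltW Y0); have h2 := dgap_le mu_sqr (ltW Y0).
have eD := fD_y0 s0.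
set Y := y0 (sc + t) in Y0 hL h1 h2 eD *.
have g0 := gG_gt0 mu_sqr mean_gt0 Y0.
apply/andP; split; rewrite -(ler_pM2l Y0) eD.
  have -> : Y * (sc * tanh_dgap_cst * c * G Y) = sc * (tanh_dgap_cst * (c * (Y * G Y))) by ring.
  have h3 := le_trans (ler_wpM2l (ltW k0) hL) h1.
  have h4 : 0 <= tanh_dgap_cst * (c * (Y * G Y)).
    by apply: mulr_ge0; first exact: ltW; rewrite !mulr_ge0// ltW.
  apply: le_trans (ler_wpM2l (ltW scp) h3) _.
  by rewrite ler_wpM2r ?(le_trans h4)// lerDl ltW.
apply: le_trans (ler_wpM2l (ltW s0) h2) _.
have -> : Y * (2 * sc * G Y) = (2 * sc) * (Y * G Y) by ring.
by rewrite ler_wpM2r ?mulr_ge0 ?ltW//; lra.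
Qed.

Lemma cmp_inv (f : R -> R) : cmp f id -> cmp (fun t => (f t)^-1) (fun t => t^-1).
Proof.
move=> [c [C [d [c0 C0 d0 H]]]]; exists C^-1, c^-1, d; split; rewrite ?invr_gt0//.
move=> t t0 td; have /andP[h1 h2] := H t t0 td.
have ct : 0 < c * t by exact: mulr_gt0.
have f0 : 0 < f t by exact: lt_le_trans h1.
by rewrite -!invfM !lef_pV2 ?posrE ?mulr_gt0// h1 h2.
Qed.

Lemma cmp_chi_super : cmp L (fun y => y * G y) ->
  cmp (fun t => fchi mu (sc + t) (y0 (sc + t)) 0) (fun t => t^-1).
Proof.
move=> /cmp_fD_super/cmp_inv [c [C [d [c0 C0 d0 H]]]].
have m0 := meansq_gt0; have scp := sc_gt0.
(* Once y0 is below this threshold, P lies between m1/2 and m1, so the divergence comes from 1/D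
   alone. *)
have e0 : 0 < m1 / (2 * m2) by rewrite divr_gt0// mulr_gt0.
have [d' d'0 hd'] := tends0_super e0.
exists (sc * (m1 / 2) ^+ 2 * c), (1 + 2 * sc * m1 ^+ 2 * C).
exists (Num.min (Num.min d sc) (Num.min d' 1)); split.
- by rewrite mulr_gt0// mulr_gt0// exprn_gt0// divr_gt0.
- by rewrite addr_gt0// mulr_gt0// mulr_gt0 ?exprn_gt0// mulr_gt0.
- by rewrite !lt_min d0 scp d'0 ltr01.
move=> t t0; rewrite !lt_min => /andP[/andP[td tsc] /andP[td' t1]].
have /andP[h1 h2] := H t t0 td; have [u0 ue] := hd' t t0 td'.
rewrite /fchi; set Y := y0 (sc + t) in h1 h2 u0 ue *.
move: h1 h2; set I := (fD _ _ _ _)^-1 => h1 h2.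
have it1 : 1 <= t^-1 by rewrite invf_ge1// ltW.
have I0 : 0 <= I by apply: le_trans h1; rewrite mulr_ge0 ?(ltW c0)//; lra.
have S0 := fS_ge0 mu Y 0; have S1 := fS_le1 mu_sqr Y 0.
have P1 := fP_le mu_sqr Y 0.
have P0 : m1 / 2 <= fP mu Y 0.
  apply: le_trans (fP_ge mu_sqr (ltW u0)).
  move: ue; rewrite ltr_pdivlMr ?mulr_gt0//; lra.
set P := fP mu Y 0 in P0 P1 *.
have mh : 0 <= m1 / 2 by rewrite divr_ge0// ltW.
have m10 := ltW mean_gt0; have Pge0 : 0 <= P by exact: le_trans P0.
have P2 : P ^+ 2 <= m1 ^+ 2 by rewrite lerXn2r.
have P3 : (m1 / 2) ^+ 2 <= P ^+ 2 by rewrite lerXn2r.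
have q0 : 0 <= (sc + t) * P ^+ 2 by rewrite mulr_ge0 ?sqr_ge0//; lra.
apply/andP; split.
  apply: le_trans (_ : (sc + t) * P ^+ 2 * I <= _); last by rewrite lerDr.
  rewrite -mulrA; apply: ler_pM => //.
  - by rewrite mulr_ge0 ?sqr_ge0// ltW.
  - by rewrite mulr_ge0 ?(ltW c0)//; lra.
  - by apply: ler_pM => //; [exact: ltW|exact: sqr_ge0|rewrite lerDl ltW].
have -> : (1 + 2 * sc * m1 ^+ 2 * C) / t = t^-1 + 2 * sc * m1 ^+ 2 * (C / t).
  by ring.
apply: lerD; first lra.
apply: ler_pM => //; apply: ler_pM => //; [lra|exact: sqr_ge0|lra].
Qed.

Lemma fQ00 : fQ mu 0 0 = m2.
Proof.
rewrite fQ.unlock meansq.unlock; apply: eq_Ex => x _.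
rewrite mulr0 addr0 (_ : dtanh 0 = 1) ?mul1r//.
by have -> : dtanh 0 = 1 - tanh 0 ^+ 2 :> R by []; rewrite tanh0 expr0n subr0.
Qed.

Lemma fP00 : fP mu 0 0 = m1.
Proof.
rewrite fP.unlock mean.unlock; apply: eq_Ex => x _.
rewrite mulr0 addr0 (_ : dtanh 0 = 1) ?mul1r//.
by have -> : dtanh 0 = 1 - tanh 0 ^+ 2 :> R by []; rewrite tanh0 expr0n subr0.
Qed.

Lemma fD_sub t : t < sc -> 0 < t -> fD mu (sc - t) (y0 (sc - t)) 0 = m2 * t.
Proof.
move=> tsc t0; have m0 := meansq_gt0; have e := sc_mul.
rewrite y0_eq0 ?subr_gt0//; first by rewrite /fD fQ00 mulrBl e; ring.
by rewrite mulrBl e gtrBl mulr_gt0.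
Qed.

Lemma cmp_chi_sub : cmp (fun t => fchi mu (sc - t) (y0 (sc - t)) 0) (fun t => t^-1).
Proof.
have m0 := meansq_gt0; have scp := sc_gt0.
exists (sc / 2 * m1 ^+ 2 / m2), (1 + sc * m1 ^+ 2 / m2), (Num.min (sc / 2) 1); split.
- by rewrite divr_gt0// mulr_gt0 ?exprn_gt0// divr_gt0.
- by rewrite addr_gt0// divr_gt0// mulr_gt0 ?exprn_gt0.
- by rewrite lt_min ltr01 andbT divr_gt0.
move=> t t0; rewrite lt_min => /andP[ts t1].
have tsc : t < sc by lra.
rewrite /fchi fD_sub//; have S0 := fS_ge0 mu (y0 (sc - t)) 0.
have S1 := fS_le1 mu_sqr (y0 (sc - t)) 0.
have -> : fP mu (y0 (sc - t)) 0 = m1.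
  rewrite y0_eq0 ?fP00 ?subr_gt0//.
  by rewrite mulrBl sc_mul gtrBl mulr_gt0.
have it1 : 1 <= t^-1 by rewrite invf_ge1// ltW.
have q0 : 0 <= m1 ^+ 2 / m2 * t^-1.
  by rewrite mulr_ge0// ?divr_ge0 ?sqr_ge0 ?ltW//; lra.
have -> : (sc - t) * m1 ^+ 2 / (m2 * t) = (sc - t) * (m1 ^+ 2 / m2 * t^-1).
  by rewrite invfM; ring.
have -> : sc / 2 * m1 ^+ 2 / m2 / t = sc / 2 * (m1 ^+ 2 / m2 * t^-1) by ring.
have -> : (1 + sc * m1 ^+ 2 / m2) / t = t^-1 + sc * (m1 ^+ 2 / m2 * t^-1) by ring.
apply/andP; split.
  apply: le_trans (_ : (sc - t) * (m1 ^+ 2 / m2 * t^-1) <= _); last by rewrite lerDr.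
  by rewrite ler_wpM2r//; lra.
by apply: lerD; [lra|rewrite ler_wpM2r//; lra].
Qed.

End Asymptotics.

(** * The limiting annealed quantities *)

Section WeightLaw.
Context {R : realType} (mu : probability R R) (w : nat -> nat -> R).
Hypothesis wr : weight_regularity w mu.

(* The test function 1 - exp(x - |x|) vanishes at every weight, hence has
   integral 0 against the limit law, but it is positive on the negatives. *)
Lemma weight_nonneg_ae : {ae mu, forall x : R, `|x| = x}.
Proof.
have [w0 [wd _]] := wr.
pose f (x : R) := 1 - expR (x - `|x|).
have fc : continuous f.
  move=> x; apply: cvgB; first exact: cvg_cst.
  apply: continuous_comp; last exact: continuous_expR.
  by apply: cvgB; [exact: cvg_id|exact: norm_continuous].
have xle (x : R) : x - `|x| <= 0 by rewrite subr_le0 ler_norm.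
have f0 x : 0 <= f x by rewrite subr_ge0 -expR0 ler_expR.
have f1 x : f x <= 1 by rewrite lerBlDr lerDl expR_ge0.
have fz x : 0 <= x -> f x = 0.
  by move=> x0; rewrite /f ger0_norm// subrr expR0 subrr.
have := wd f fc (ex_intro _ 1 _).
have /[swap] /[apply] : forall x, `|f x| <= 1 by move=> x; rewrite ger0_norm.
under eq_fun => N.
  rewrite big1 => [|i _]; last by rewrite fz// ltW// w0.
  rewrite mulr0; over.
move=> h; have e : (\int[mu]_x (f x)%:E = 0)%E.
  by apply/esym/(cvg_unique _ _ h) => //; exact: cvg_cst.
have mf : measurable_fun setT f by exact: continuous_measurable_fun.
have : (\int[mu]_x `|(f x)%:E| = 0)%E.
  by rewrite -[RHS]e; apply: eq_integral => x _; rewrite gee0_abs// lee_fin.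
move/ae_eq_integral_abs => /(_ measurableT).
have mf' : measurable_fun setT (fun x => (f x)%:E) by exact/measurable_EFinP.
move=> /(_ mf'); apply: filterS => x /= /(_ I) [] /eqP.
rewrite subr_eq0 -expR0 => /eqP/expR_inj/esym/eqP.
by rewrite subr_eq0 => /eqP.
Qed.

Lemma integral_normE (f : R -> R) : measurable_fun setT f ->
  (\int[mu]_x (f x)%:E = \int[mu]_x (f `|x|)%:E)%E.
Proof.
move=> mf; apply: ae_eq_integral => //.
- exact/measurable_EFinP.
- by apply/measurable_EFinP; apply: measurableT_comp => //; exact: normr_measurable.
by apply: filterS weight_nonneg_ae => x e _; rewrite e.
Qed.

Lemma Ew_Ex (f : R -> R) : measurable_fun setT f -> Ew mu f = Ex mu f.
Proof. by move=> mf; rewrite /Ew integral_normE. Qed.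

Lemma weight_sqr : (\int[mu]_x (x ^+ 2)%:E < +oo)%E.
Proof. by have [_ [_ [_ []]]] := wr. Qed.

Lemma EW_mean : EW mu = mean mu.
Proof. by rewrite /EW Ew_Ex ?mean.unlock//; exact: measurable_id. Qed.

Lemma EW2_meansq : EW2 mu = meansq mu.
Proof. by rewrite /EW2 Ew_Ex ?meansq.unlock//; exact: measurable_funX. Qed.

Lemma weight_mean_gt0 : 0 < mean mu.
Proof.
have [_ [_ [_ [_ h]]]] := wr.
have a1 : adm 2 (fun x : R => x) by exact: admW adm_id.
have /integrable_fin_num fn := adm_integrable weight_sqr a1.
rewrite (@integral_normE id) in h; last exact: measurable_id.
by rewrite mean.unlock /Ex /Rintegral -lte_fin fineK ?fn.
Qed.

Lemma tailpE t : (tailp mu t)%:E = mu `]t, +oo[%classic.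
Proof.
rewrite tailp.unlock -Ew_Ex; last by have [] := adm_indgt t.
rewrite /Ew indgtE integral_indic// setIT fineK//.
exact: fin_num_measure.
Qed.

Lemma power_law_tail tau : power_law mu tau -> exists c C w0 : R,
  [/\ 0 < c, 0 < C, 1 < w0 & forall t, w0 < t ->
    c * t `^ (- ((tau - 3) + 2)) <= tailp mu t <= C * t `^ (- ((tau - 3) + 2))].
Proof.
move=> [c [C [w0 [c0 [cC [w01 H]]]]]]; exists c, C, w0; split => //.
  exact: lt_trans cC.
move=> t /H; rewrite -tailpE !lee_fin.
by have -> : tau - 3 + 2 = tau - 1 by ring.
Qed.

Lemma gL_cube y : 0 < y -> y < 1 -> y ^+ 3 * gL mu 1 <= gL mu y.
Proof.
move=> y0 y1; have y0' := ltW y0.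
have m := weight_sqr; rewrite gL.unlock -ExZ//; last by adm.
apply: le_Ex => //; [by adm..|] => x x0; rewrite mulr1 mulrCA ler_wpM2l//.
have x3 : 0 <= x ^+ 3 by exact: exprn_ge0.
have y3 : 0 <= y ^+ 3 by exact: exprn_ge0.
have y31 : y ^+ 3 <= 1 by rewrite exprn_ile1// ltW.
rewrite exprMn le_min mulrC ler_wpM2r//=; last by rewrite ge_min lexx.
by rewrite mulr_ile1 ?min1_ge0// ge_min lexx orbT.
Qed.

(** Up to 1/e the integrand of G(1) is at most [A] times that of L(1); beyond 1/e it is bounded by
    that of [omega e], and e is chosen so that this accounts for at most half of G(1). *)
Lemma gL1_gt0 : 0 < gL mu 1.
Proof.
have m := weight_sqr; have p := weight_mean_gt0.
have g0 : 0 < gG mu 1 by exact: (gG_gt0 m p ltr01).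
have [e e0 he] := @omega_small R mu m (gG mu 1 / 2) (divr_gt0 g0 (ltr0Sn _ 1)).
pose A := 1 + e^-1; have ie : 0 < e^-1 by rewrite invr_gt0.
have A1 : 1 <= A by rewrite /A; lra.
suff : gG mu 1 <= A * gL mu 1 + omega mu e.
  move=> h; have : 0 < A * gL mu 1 by lra.
  by rewrite pmulr_rgt0//; lra.
rewrite gG.unlock gL.unlock omega.unlock -ExZ//; last by adm.
have e0' := ltW e0; rewrite -ExD//; [|by adm..].
apply: le_Ex => //; [by adm..|] => x x0; rewrite mulr1.
have x2 := sqr_ge0 x.
have [x1|/ltW x1] := leP x 1.
  rewrite (@min_l _ _ (x ^+ 2)) ?exprn_ile1// (@min_l _ _ (x ^+ 3)) ?exprn_ile1//.
  have : 0 <= x ^+ 2 * Num.min (x * e) 1 by rewrite mulr_ge0// min1_ge0// mulr_ge0.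
  have : x ^+ 2 * x ^+ 2 <= A * (x * x ^+ 3).
    have -> : x * x ^+ 3 = x ^+ 2 * x ^+ 2 by ring.
    by rewrite ler_peMl// mulr_ge0.
  lra.
rewrite (@min_r _ _ (x ^+ 2)) ?exprn_ege1// (@min_r _ _ (x ^+ 3)) ?exprn_ege1//.
rewrite !mulr1; have [xe|xe] := leP (x * e) 1.
  have : x <= e^-1 by rewrite -[e^-1]mul1r ler_pdivlMr.
  have : 0 <= x ^+ 2 * (x * e) by rewrite mulr_ge0// mulr_ge0.
  rewrite /A; nra.
have := mulr_ge0 (le_trans ler01 A1) x0; lra.
Qed.

End WeightLaw.

(** * Transfer from s = g(beta) / E[W] to the inverse temperature *)

Section Model.
Context {R : realType} (mu : probability R R) (w : nat -> nat -> R).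
Hypothesis wr : weight_regularity w mu.
Variables (g : R -> R) (bc slope : R).
Hypothesis slope_gt0 : 0 < slope.
Hypothesis g_slope : is_derive bc 1 g slope.
Hypothesis g_bc : g bc = (nuW mu)^-1.
Implicit Types (t B beta : R).

Let mu_sqr := weight_sqr wr.
Let mean_gt0 := weight_mean_gt0 wr.
Local Notation m1 := (mean mu).
Local Notation m2 := (meansq mu).
Local Notation sc := (sc mu).
Local Notation y0 := (y0 mu).

Definition strength beta : R := g beta / m1.

Lemma strength_bc : strength bc = sc.
Proof.
rewrite /strength g_bc /nuW (EW_mean wr) (EW2_meansq wr) invf_div mulrAC.
by rewrite divff ?mul1r// gt_eqF// mean_gt0.
Qed.

Lemma g_near_bc : exists2 d, 0 < d & forall h, h != 0 -> `|h| < d ->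
  slope / 2 <= h^-1 * (g (h + bc) - g bc) <= 2 * slope.
Proof.
have [dg eg] := g_slope.
have : h^-1 *: (g (h *: 1 + bc) - g bc) @[h --> 0^'] --> slope.
  by rewrite -eg; exact: dg.
have s2 : 0 < slope / 2 by rewrite divr_gt0.
move/cvgrPdist_le => /(_ _ s2) [d /= d0 hd].
exists d => // h h0 hh; have := hd h.
rewrite /ball_ /= sub0r normrN => /(_ hh h0).
rewrite scaler1 -[_ *: _]/(_ * _) ler_norml; lra.
Qed.

Lemma cmp_strength_right : cmp (fun t => strength (bc + t) - sc) id.
Proof.
have [d d0 hd] := g_near_bc; have m0 := mean_gt0.
exists (slope / 2 / m1), (2 * slope / m1), d; split; rewrite ?divr_gt0 ?mulr_gt0//.
move=> t t0 td; have := hd t; rewrite gt_eqF// ger0_norm ?(ltW t0)//.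
move=> /(_ isT td); rewrite -strength_bc /strength -mulrBl (addrC bc).
rewrite ler_pdivlMl// ler_pdivrMl// => /andP[h1 h2].
by rewrite !(mulrAC _ m1^-1) !ler_pM2r ?invr_gt0//= mulrC h1 [_ * t]mulrC.
Qed.

Lemma cmp_strength_left : cmp (fun t => sc - strength (bc - t)) id.
Proof.
have [d d0 hd] := g_near_bc; have m0 := mean_gt0.
exists (slope / 2 / m1), (2 * slope / m1), d; split; rewrite ?divr_gt0 ?mulr_gt0//.
move=> t t0 td; have := hd (- t); rewrite oppr_eq0 gt_eqF// normrN ger0_norm ?(ltW t0)//.
move=> /(_ isT td); rewrite -strength_bc /strength -mulrBl (addrC bc).
have -> : (- t)^-1 * (g (- t + bc) - g bc) = t^-1 * (g bc - g (- t + bc)).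
  by rewrite invrN mulNr -mulrN opprB.
rewrite ler_pdivlMl// ler_pdivrMl// => /andP[h1 h2].
by rewrite !(mulrAC _ m1^-1) !ler_pM2r ?invr_gt0//= mulrC h1 [_ * t]mulrC.
Qed.

Lemma cmp_id_tends0 (u : R -> R) : cmp u id -> tends0 u.
Proof.
move=> [c [C [d [c0 C0 d0 H]]]] e e0; exists (Num.min d (e / C)).
  by rewrite lt_min d0 divr_gt0.
move=> t t0; rewrite lt_min => /andP[td te]; have /andP[h1 h2] := H t t0 td.
split; first by apply: lt_le_trans h1; exact: mulr_gt0.
by apply: le_lt_trans h2 _; rewrite mulrC -ltr_pdivlMr.
Qed.

Lemma near_right (P : R -> Prop) :
  (exists2 d, 0 < d & forall t, 0 < t -> t < d -> P (bc + t)) ->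
  \forall beta \near bc^'+, P beta.
Proof.
move=> [d d0 H]; near=> beta.
have b1 : bc < beta by near: beta; exact: nbhs_right_gt.
have b2 : beta < bc + d by near: beta; apply: nbhs_right_lt; lra.
have -> : beta = bc + (beta - bc) by ring.
by apply: H; lra.
Unshelve. all: by end_near. Qed.

Lemma near_left (P : R -> Prop) :
  (exists2 d, 0 < d & forall t, 0 < t -> t < d -> P (bc - t)) ->
  \forall beta \near bc^'-, P beta.
Proof.
move=> [d d0 H]; near=> beta.
have b1 : beta < bc by near: beta; exact: nbhs_left_lt.
have b2 : bc - d < beta by near: beta; apply: nbhs_left_gt; lra.
have -> : beta = bc - (bc - beta) by ring.
by apply: H; lra.
Unshelve. all: by end_near. Qed.

Lemma near_both (P : R -> Prop) :
  P bc ->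
  (exists2 d, 0 < d & forall t, 0 < t -> t < d -> P (bc + t)) ->
  (exists2 d, 0 < d & forall t, 0 < t -> t < d -> P (bc - t)) ->
  \forall beta \near bc, P beta.
Proof.
move=> P0 [d d0 H] [d' d'0 H'].
exists (Num.min d d'); first by rewrite /= lt_min d0.
move=> beta /=; rewrite lt_min ltr_norml ltr_norml => /andP[/andP[h1 h2] /andP[h3 h4]].
have [b|b|->//] := ltgtP beta bc.
  have -> : beta = bc - (bc - beta) by ring.
  by apply: H'; lra.
have -> : beta = bc + (beta - bc) by ring.
by apply: H; lra.
Qed.

Lemma strength_right_gt0 : exists2 d, 0 < d &
  forall t, 0 < t -> t < d -> 0 < strength (bc + t).
Proof.
have [d d0 H] := cmp_id_tends0 cmp_strength_right ltr01.
exists d => // t t0 td; have [h _] := H t t0 td.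
by have := sc_gt0 mu_sqr mean_gt0; lra.
Qed.

Lemma strength_left_gt0 : exists2 d, 0 < d &
  forall t, 0 < t -> t < d -> 0 < strength (bc - t).
Proof.
have [d d0 H] := cmp_id_tends0 cmp_strength_left (sc_gt0 mu_sqr mean_gt0).
by exists d => // t t0 td; have [_ h] := H t t0 td; lra.
Qed.

Lemma fpmapE beta B z : fpmap g mu beta B z =
  alphaW g mu beta * fF mu (alphaW g mu beta * z) B.
Proof.
rewrite /fpmap; set a := alphaW _ _ _.
transitivity (Ew mu (fun x => a * (tanh (x * (a * z) + B) * x))).
  by congr (Ew mu _); apply/funext => x; rewrite mulrCA (mulrC a x) (mulrA x).
have ad : adm 2 (fun x => tanh (x * (a * z) + B) * x) by adm.
rewrite (Ew_Ex wr); last by have [] := adm_scale a ad.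
by rewrite ExZ// fF.unlock.
Qed.

(** Multiplying the equation for z by alpha gives y = alpha^2 F(y, B) with alpha^2 = s; uniqueness
    of the positive solution identifies the two choices. *)
Lemma alphaW_zstar beta B : 0 < strength beta -> 0 < B ->
  alphaW g mu beta * zstar g mu beta B = ystar mu (strength beta) B.
Proof.
move=> s0 B0; have [Y0 eY] := ystarP mu_sqr mean_gt0 s0 B0.
set Y := ystar _ _ _ in Y0 eY *; set a := alphaW g mu beta.
have a0 : 0 < a by rewrite sqrtr_gt0 (EW_mean wr).
have a2 : a * a = strength beta.
  by rewrite -expr2 sqr_sqrtr (EW_mean wr)// ltW.
pose S := [set z | 0 < z /\ z = fpmap g mu beta B z].
(* A witness is needed so that [zstar] is a genuine solution and not its default 0. *)
have hS : S (Y / a).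
  split; first exact: divr_gt0.
  rewrite fpmapE -/a mulrCA mulfV ?mulr1 ?gt_eqF// {1}eY -a2.
  by field; rewrite gt_eqF.
have [z0 ez] : S (zstar g mu beta B) by exact: (xgetPex 0 (ex_intro _ _ hS)).
move: z0 ez; set z := zstar _ _ _ _ => z0 ez.
apply: (fixpoint_unique mu_sqr mean_gt0 s0 B0) => //; first exact: mulr_gt0.
by rewrite {1}ez fpmapE -/a mulrA a2.
Qed.

Lemma Mt_mag beta B : 0 < strength beta -> 0 < B ->
  Mt g mu beta B = mag mu (strength beta) B.
Proof.
move=> s0 B0; rewrite /mag -alphaW_zstar// /Mt; set a := alphaW _ _ _.
set z := zstar _ _ _ _.
rewrite fM.unlock -(Ew_Ex wr); last by have [] := adm_tanh (a * z) B.
by congr (Ew mu _); apply/funext => x; rewrite mulrA (mulrC x).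
Qed.

Lemma near_Mt_mag beta B : 0 < strength beta -> 0 < B ->
  \near B, mag mu (strength beta) B = Mt g mu beta B.
Proof.
move=> s0 B0; near=> b; rewrite Mt_mag//.
by near: b; exact: lt_nbhsr.
Unshelve. all: by end_near. Qed.

Lemma is_derive_Mt beta B : 0 < strength beta -> 0 < B ->
  is_derive B 1 (Mt g mu beta) (chi mu (strength beta) B).
Proof.
move=> s0 B0; apply: (near_eq_is_derive (near_Mt_mag s0 B0)).
exact: (is_derive_mag mu_sqr mean_gt0 s0 B0).
Qed.

Lemma chit_chi beta B : 0 < strength beta -> 0 < B ->
  chit g mu beta B = chi mu (strength beta) B.
Proof.
by move=> s0 B0; rewrite /chit derive1E; have [_ ->] := is_derive_Mt s0 B0.
Qed.

Lemma Mt_cvg0 beta : 0 < strength beta ->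
  Mt g mu beta B @[B --> 0^'+] --> fM mu (y0 (strength beta)) 0.
Proof.
move=> s0; apply: cvg_trans (mag_cvg0 mu_sqr mean_gt0 s0).
apply: near_eq_cvg; near do rewrite Mt_mag//.
Unshelve. all: by end_near. Qed.

Lemma Mt0E beta : 0 < strength beta ->
  Mt0 g mu beta = fM mu (y0 (strength beta)) 0.
Proof. by move=> s0; apply: cvg_lim => //; exact: Mt_cvg0. Qed.

Lemma chit_cvg0 beta : 0 < strength beta ->
  0 < fD mu (strength beta) (y0 (strength beta)) 0 ->
  chit g mu beta B @[B --> 0^'+] --> fchi mu (strength beta) (y0 (strength beta)) 0.
Proof.
move=> s0 D0; have D0' : fD mu (strength beta) (y0 (strength beta)) 0 != 0.
  by rewrite gt_eqF.
apply: cvg_trans (chi_cvg0 mu_sqr mean_gt0 s0 D0').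
apply: near_eq_cvg; near do rewrite chit_chi//.
Unshelve. all: by end_near. Qed.

Lemma chit0E beta : 0 < strength beta ->
  0 < fD mu (strength beta) (y0 (strength beta)) 0 ->
  chit0 g mu beta = fchi mu (strength beta) (y0 (strength beta)) 0.
Proof. by move=> s0 D0; apply: cvg_lim => //; exact: chit_cvg0. Qed.

Lemma cmp_ratio (f h : R -> R) (d : R) : 0 < d ->
  (forall t, 0 < t -> t < d -> 0 < h t) -> cmp f h ->
  exists c C : R, 0 < c /\ 0 < C /\ exists2 d, 0 < d &
    forall t, 0 < t -> t < d -> c <= f t / h t <= C.
Proof.
move=> d0 h0 [c [C [d' [c0 C0 d'0 H]]]]; exists c, C; do 2 split => //.
exists (Num.min d d'); first by rewrite lt_min d0.
move=> t t0; rewrite lt_min => /andP[td td'].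
by rewrite ler_pdivlMr ?ler_pdivrMr ?h0//; exact: H.
Qed.

Lemma asymp_right (f h : R -> R) (d : R) : 0 < d ->
  (forall t, 0 < t -> t < d -> 0 < h (bc + t)) ->
  cmp (fun t => f (bc + t)) (fun t => h (bc + t)) -> asymp bc^'+ f h.
Proof.
move=> d0 h0 /(cmp_ratio d0 h0) [c [C [c0 [C0 H]]]].
by exists c, C; do 2 split => //; exact: near_right.
Qed.

Lemma asymp_left (f h : R -> R) (d : R) : 0 < d ->
  (forall t, 0 < t -> t < d -> 0 < h (bc - t)) ->
  cmp (fun t => f (bc - t)) (fun t => h (bc - t)) -> asymp bc^'- f h.
Proof.
move=> d0 h0 /(cmp_ratio d0 h0) [c [C [c0 [C0 H]]]].
by exists c, C; do 2 split => //; exact: near_left.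
Qed.

Lemma asymp_zero (f h : R -> R) (d : R) : 0 < d ->
  (forall t, 0 < t -> t < d -> 0 < h t) -> cmp f h -> asymp 0^'+ f h.
Proof.
move=> d0 h0 /(cmp_ratio d0 h0) [c [C [c0 [C0 [d' d'0 H]]]]].
exists c, C; do 2 split => //; near=> t; apply: H.
  by near: t; exact: nbhs_right_gt.
by near: t; exact: nbhs_right_lt.
Unshelve. all: by end_near. Qed.

Lemma Mt0_right_cmp : cmp (fun t => Mt0 g mu (bc + t)) (fun t => y0 (strength (bc + t))).
Proof.
have [d d0 hd] := strength_right_gt0.
have := cmp_comp (cmp_id_tends0 cmp_strength_right) (cmp_fM_super mu_sqr mean_gt0).
apply: (eq_cmp d0) => t t0 td; last by congr (y0 _); ring.
by rewrite Mt0E ?hd//; congr (fM mu (y0 _) 0); ring.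
Qed.

Lemma tends0_y0_right : tends0 (fun t => y0 (strength (bc + t))).
Proof.
move=> e /(tends0_super mu_sqr mean_gt0) [d d0 H].
have [d' d'0 H'] := cmp_id_tends0 cmp_strength_right d0.
exists d' => // t t0 td; have [h1 h2] := H' t t0 td.
by have := H _ h1 h2; rewrite addrC subrK.
Qed.

Lemma cmp_gG_right : cmp (fun t => gG mu (y0 (strength (bc + t)))) id.
Proof.
have := cmp_comp (cmp_id_tends0 cmp_strength_right) (cmp_super mu_sqr mean_gt0).
move=> h; apply: cmp_trans cmp_strength_right.
apply: (eq_cmp ltr01) h => // t _ _.
by congr (gG mu (y0 _)); ring.
Qed.

Lemma Mt_crit_cmp : cmp (Mt g mu bc) (ystar mu sc).
Proof.
have scp := sc_gt0 mu_sqr mean_gt0.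
apply: (eq_cmp ltr01) (cmp_mag_crit mu_sqr mean_gt0) => // B B0 _.
by rewrite Mt_mag ?strength_bc.
Qed.

Lemma Mt_right_cvg : \forall beta \near bc^'+, cvg (Mt g mu beta B @[B --> 0^'+]).
Proof.
apply: near_right; have [d d0 hd] := strength_right_gt0.
exists d => // t t0 td; apply/cvg_ex; eexists.
exact: Mt_cvg0 (hd t t0 td).
Qed.

Lemma Mt_derivable :
  \forall beta \near bc, forall B, 0 < B -> derivable (Mt g mu beta) B 1.
Proof.
apply: near_both.
- move=> B B0; have scp := sc_gt0 mu_sqr mean_gt0.
  by have [|//] := @is_derive_Mt bc B _ B0; rewrite strength_bc.
- have [d d0 hd] := strength_right_gt0.
  by exists d => // t t0 td B B0; have [] := is_derive_Mt (hd t t0 td) B0.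
- have [d d0 hd] := strength_left_gt0.
  by exists d => // t t0 td B B0; have [] := is_derive_Mt (hd t t0 td) B0.
Qed.

Lemma fD_left_gt0 : exists2 d, 0 < d & forall t, 0 < t -> t < d ->
  0 < strength (bc - t) /\
  0 < fD mu (strength (bc - t)) (y0 (strength (bc - t))) 0.
Proof.
have [d d0 H] := cmp_id_tends0 cmp_strength_left (sc_gt0 mu_sqr mean_gt0).
exists d => // t t0 td; have [h1 h2] := H t t0 td; split; first lra.
have -> : strength (bc - t) = sc - (sc - strength (bc - t)) by ring.
rewrite (fD_sub mu_sqr mean_gt0)//.
by apply: mulr_gt0 => //; exact: meansq_gt0.
Qed.

(** Positivity of D at zero field is read off from its being of order s - sc. *)
Lemma fD_right_gt0 : cmp (gL mu) (fun y => y * gG mu y) ->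
  exists2 d, 0 < d & forall t, 0 < t -> t < d ->
  0 < strength (bc + t) /\
  0 < fD mu (strength (bc + t)) (y0 (strength (bc + t))) 0.
Proof.
move=> /(cmp_fD_super mu_sqr mean_gt0)/cmp_id_tends0/(_ 1 ltr01) [e e0 He].
have [d d0 H] := cmp_id_tends0 cmp_strength_right e0.
exists d => // t t0 td; have [h1 h2] := H t t0 td.
have := sc_gt0 mu_sqr mean_gt0 => scp; split; first lra.
by have [] := He _ h1 h2; rewrite addrC subrK.
Qed.

(** G(y0) of order beta - bc gives the exponent 1/p, and y G(y) of order B gives p + 1. The
    susceptibility follows 1/D, where D is of order |beta - bc| on both sides whatever p is. *)
Lemma crit_exponents_of_cmp (p : R) : 0 < p ->
  cmp (gG mu) (fun y => y `^ p) -> cmp (gL mu) (fun y => y * gG mu y) ->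
  crit_exponents g mu bc p^-1 (p + 1) 1 1.
Proof.
move=> p0 hG hL; have p1 : 0 < p + 1 by lra.
have bcK (t : R) : bc + t - bc = t by ring.
have bcK' (t : R) : bc - (bc - t) = t by ring.
split; first exact: Mt_right_cvg.
split; first exact: Mt_derivable.
split.
  apply: near_left; have [d d0 H] := fD_left_gt0; exists d => // t t0 td.
  have [s0 D0] := H t t0 td; apply/cvg_ex; eexists; exact: chit_cvg0.
split.
  apply: near_right; have [d d0 H] := fD_right_gt0 hL; exists d => // t t0 td.
  have [s0 D0] := H t t0 td; apply/cvg_ex; eexists; exact: chit_cvg0.
split.
  apply: (asymp_right ltr01) => [t t0 _|]; first by rewrite bcK powR_gt0.
  apply: cmp_trans Mt0_right_cmp _.
  apply: (eq_cmp ltr01) (cmp_inv_powR p0 tends0_y0_right hG cmp_gG_right) => // t _ _.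
  by rewrite bcK.
split.
  apply: (asymp_zero ltr01) => [t t0 _|]; first exact: powR_gt0.
  apply: cmp_trans Mt_crit_cmp _.
  apply: (@cmp_inv_powR _ (fun y => y * gG mu y)) => //.
  - exact: tends0_crit.
  - have [c [C [d [c0 C0 d0 H]]]] := hG; exists c, C, d; split => // y y0 yd.
    have y0' := ltW y0; rewrite powRDp// powRr1//.
    have /andP[h1 h2] := H y y0 yd.
    have := ler_wpM2l y0' h1; have := ler_wpM2l y0' h2.
    move: (y `^ p) => q; lra.
  - exact: cmp_crit.
split.
  apply: (asymp_left ltr01) => [t t0 _|]; first by rewrite bcK' powR_gt0.
  have [d d0 H] := fD_left_gt0.
  have h1 := cmp_comp (cmp_id_tends0 cmp_strength_left) (cmp_chi_sub mu_sqr mean_gt0).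
  have h2 := cmp_trans h1 (cmp_inv cmp_strength_left).
  apply: (eq_cmp d0) h2 => t t0 td.
    have [s0 D0] := H t t0 td; rewrite chit0E//.
    by have -> : sc - (sc - strength (bc - t)) = strength (bc - t) by ring.
  by rewrite bcK' powR_inv1// ltW.
apply: (asymp_right ltr01) => [t t0 _|]; first by rewrite bcK powR_gt0.
have [d d0 H] := fD_right_gt0 hL.
have h1 := cmp_comp (cmp_id_tends0 cmp_strength_right) (cmp_chi_super mu_sqr mean_gt0 hL).
have h2 := cmp_trans h1 (cmp_inv cmp_strength_right).
apply: (eq_cmp d0) h2 => t t0 td.
  have [s0 D0] := H t t0 td; rewrite chit0E//.
  by have -> : sc + (strength (bc + t) - sc) = strength (bc + t) by ring.
by rewrite bcK powR_inv1// ltW.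
Qed.

Lemma boundary_case_of_cmp :
  cmp (gG mu) (fun y => y ^+ 2 * ln y^-1) -> boundary_case g mu bc.
Proof.
move=> hG; have bcK (t : R) : bc + t - bc = t by ring.
have lpos (t r : R) : 0 < t -> t < 1 -> 0 < (t / ln t^-1) `^ r.
  move=> t0 t1; rewrite powR_gt0// divr_gt0// ln_gt0//.
  by rewrite -(invr1 R) ltf_pV2 ?posrE.
split; first exact: Mt_right_cvg.
split.
  apply: (asymp_right ltr01) => [t t0 t1|]; first by rewrite bcK lpos.
  apply: cmp_trans Mt0_right_cmp _.
  apply: (eq_cmp ltr01) (cmp_inv_powR_log tends0_y0_right hG cmp_gG_right) => // t _ _.
  by rewrite bcK.
apply: (asymp_zero ltr01) => [t t0 t1|]; first exact: lpos.
apply: cmp_trans Mt_crit_cmp _.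
(* The argument 1 encodes exponent 3: multiplying by y raises y^2 ln (1/y) to y^3 ln (1/y). *)
apply: (@cmp_inv_powR_log _ (fun y => y * gG mu y) 1) => //.
- exact: tends0_crit.
- have [c [C [d [c0 C0 d0 H]]]] := hG; exists c, C, d; split => // y y0 yd.
  have /andP[h1 h2] := H y y0 yd; have y0' := ltW y0.
  have := ler_wpM2l y0' h1; have := ler_wpM2l y0' h2.
  rewrite [y ^+ 3]exprS; move: (ln _) => l; lra.
- exact: cmp_crit.
Qed.

End Model.

(** * Orders of the truncated moments in the three regimes *)

Section Regimes.
Context {R : realType} (mu : probability R R) (w : nat -> nat -> R).
Hypothesis wr : weight_regularity w mu.

(* The missing lower bound on G is L(y) <= y G(y). *)
Lemma cmp_of_bounds (p c C d : R) : 0 < c -> 0 < C -> 0 < d ->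
  (forall y, 0 < y -> y < d -> gG mu y <= C * y `^ p) ->
  (forall y, 0 < y -> y < d -> c * (y * y `^ p) <= gL mu y) ->
  cmp (gG mu) (fun y => y `^ p) /\ cmp (gL mu) (fun y => y * gG mu y).
Proof.
move=> c0 C0 d0 hG hL; have m := weight_sqr wr.
have hl (y : R) : 0 < y -> gL mu y <= y * gG mu y.
  by move=> y0; exact: gL_le (ltW y0).
split.
  exists c, C, d; split => // y y0 yd; rewrite hG// andbT -(ler_pM2l y0).
  by apply: le_trans (hl y y0); rewrite mulrCA hL.
exists (c / C), 1, d; split => //; first exact: divr_gt0.
move=> y y0 yd; rewrite mul1r hl// andbT; apply: le_trans (hL y y0 yd).
rewrite -mulrA ler_wpM2l ?(ltW c0)// mulrC ler_pdivrMr// -mulrA.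
by rewrite ler_wpM2l ?(ltW y0)// mulrC hG.
Qed.

(** Dropping the truncation gives G(y) <= E[W^4] y^2, and scaling gives L(y) >= L(1) y^3 for y <
    1. *)
Lemma cmp_fourth_moment : (\int[mu]_x (x ^+ 4)%:E < +oo)%E ->
  cmp (gG mu) (fun y => y `^ 2) /\ cmp (gL mu) (fun y => y * gG mu y).
Proof.
move=> m4; have m := weight_sqr wr; have p := weight_mean_gt0 wr.
have i4 : mu.-integrable setT (fun x => (x ^+ 4)%:E).
  apply/integrableP; split.
    by apply/measurable_EFinP; apply: measurable_funX.
  have e4 (x : R) : 0 <= x ^+ 4 by rewrite (exprM x 2 2) sqr_ge0.
  by under eq_integral do rewrite gee0_abs ?lee_fin ?e4//.
pose K := \int[mu]_x (x ^+ 4).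
have K0 : 0 <= K.
  by apply: Rintegral_ge0 => x _; rewrite (exprM x 2 2) sqr_ge0.
apply: (@cmp_of_bounds 2 (gL mu 1) (K + 1) 1) => //.
- exact: (gL1_gt0 wr).
- lra.
- move=> y y0 _; rewrite powR_mulrn ?(ltW y0)//.
  apply: le_trans (_ : K * y ^+ 2 <= _); last first.
    by rewrite ler_wpM2r ?sqr_ge0//; lra.
  rewrite gG.unlock /Ex /K mulrC -RintegralZl//.
  have y0' := ltW y0; apply: le_Rintegral => //.
  + by apply: (adm_integrable m (f := fun x => x ^+ 2 * Num.min ((x * y) ^+ 2) 1)); adm.
  + exact: (integrableZl measurableT (y ^+ 2) i4).
  move=> x _; have -> : y ^+ 2 * x ^+ 4 = x ^+ 2 * (x * y) ^+ 2 by ring.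
  have -> : x ^+ 2 * (x * y) ^+ 2 = `|x| ^+ 2 * (`|x| * y) ^+ 2.
    by rewrite !exprMn real_normK ?num_real.
  by rewrite ler_wpM2l ?sqr_ge0// ge_min lexx.
- move=> y y0 y1; rewrite powR_mulrn ?(ltW y0)// -exprS mulrC.
  exact: (gL_cube wr).
Qed.

Lemma cmp_power_law tau : 3 < tau -> tau < 5 -> power_law mu tau ->
  cmp (gG mu) (fun y => y `^ (tau - 3)) /\ cmp (gL mu) (fun y => y * gG mu y).
Proof.
move=> t3 t5 /(power_law_tail wr) [c [C [w0 [c0 C0 w01 H]]]].
have m := weight_sqr wr; have p := weight_mean_gt0 wr.
have w00 : 0 < w0 by lra.
have [|||K [d [K0 d0 HK]]] := @gG_le_powR R mu m (tau - 3) C w0 _ _ (ltW C0) w00.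
- lra.
- lra.
- by move=> t /H /andP[].
apply: (@cmp_of_bounds (tau - 3) c K (Num.min d w0^-1)) => //.
- by rewrite lt_min d0 invr_gt0.
- by move=> y y0; rewrite lt_min => /andP[yd _]; exact: HK.
- move=> y y0; rewrite lt_min => /andP[_ yw].
  by apply: (gL_ge_powR m w00) => // t /H /andP[].
Qed.

Lemma cmp_power_law5 : power_law mu 5 ->
  cmp (gG mu) (fun y => y ^+ 2 * ln y^-1).
Proof.
move=> /(power_law_tail wr) [c [C [w0 [c0 C0 w01 H]]]].
have m := weight_sqr wr.
have e2 : 5 - 3 = 2 :> R by ring.
rewrite e2 in H.
have [|K [d [K0 d0 HK]]] := @gG_le_log R mu m C w0 (ltW C0) w01.
  by move=> t /H /andP[].
have [|k [d' [k0 d'0 Hk]]] := @gG_ge_log R mu m c w0 c0 w01.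
  by move=> t /H /andP[].
exists k, K, (Num.min d d'); split => //; first by rewrite lt_min d0.
by move=> y y0; rewrite lt_min => /andP[yd yd']; rewrite HK// Hk.
Qed.

End Regimes.

(** * The hyperbolic sine and its inverse *)

Section Sinh.
Context {R : realType}.
Implicit Types x y : R.

Lemma is_derive_sinh x : is_derive x 1 (@sinh R) ((expR x + expR (- x)) / 2).
Proof.
rewrite /sinh; apply: is_derive_eq; rewrite /GRing.scale /=.
by field.
Qed.

Lemma asinhK y : sinh (asinh y) = y.
Proof.
pose r := Num.sqrt (y ^+ 2 + 1).
have r2 : r ^+ 2 = y ^+ 2 + 1 by rewrite sqr_sqrtr// addr_ge0// sqr_ge0.
have r0 : 0 <= r by exact: sqrtr_ge0.
have u0 : 0 < y + r.
  have : - y < r by rewrite ltNge; apply/negP => h; nra.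
  lra.
rewrite /sinh /asinh -/r expRN lnK ?posrE//.
have un : y + r != 0 by rewrite gt_eqF.
(* After multiplication by u = y + r the claim becomes u^2 - 1 = 2 y u, which follows from r^2 = y^2
   + 1. *)
apply: (mulIf un).
have -> : (y + r - (y + r)^-1) / 2 * (y + r) = ((y + r) ^+ 2 - 1) / 2 by field.
have -> : (y + r) ^+ 2 = y ^+ 2 + 2 * y * r + r ^+ 2 by ring.
by rewrite r2; field.
Qed.

End Sinh.

Unset Implicit Arguments.

Theorem mainTheorem1 (R : realType) (mu : probability R R) (w : nat -> nat -> R) :
  weight_regularity w mu ->
  forall (g : R -> R) (bc : R),
    (g = @sinh R /\ bc = asinh (nuW mu)^-1) \/ (g = id /\ bc = (nuW mu)^-1) ->
    ((\int[mu]_x (x ^+ 4)%:E < +oo)%E -> crit_exponents g mu bc 2^-1 3 1 1) /\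
    (forall tau : R, 3 < tau -> tau < 5 -> power_law mu tau ->
       crit_exponents g mu bc (tau - 3)^-1 (tau - 2) 1 1) /\
    (power_law mu 5 -> boundary_case g mu bc).
Proof.
move=> wr g bc hg.
have p := weight_mean_gt0 wr.
have n0 : 0 < (nuW mu)^-1.
  rewrite invr_gt0 /nuW (EW_mean wr) (EW2_meansq wr) divr_gt0//.
  exact: (meansq_gt0 (weight_sqr wr) p).
(* The two models enter only here: g takes the value 1/nu at bc with positive derivative, cosh(bc)
   for [sinh] and 1 for the identity. *)
have [slope s0 [ds gb]] : exists2 slope, 0 < slope &
    is_derive bc 1 g slope /\ g bc = (nuW mu)^-1.
  case: hg => -[-> ->].
    exists ((expR (asinh (nuW mu)^-1) + expR (- asinh (nuW mu)^-1)) / 2).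
      by rewrite divr_gt0// cosh_pos.
    by split; [exact: is_derive_sinh|exact: asinhK].
  by exists 1 => //; split; first exact: is_derive_id.
split.
  move=> /(cmp_fourth_moment wr) [hG hL].
  have -> : 3 = 2 + 1 :> R by ring.
  exact: (crit_exponents_of_cmp wr s0 ds gb _ hG hL).
split.
  move=> tau t3 t5 /(cmp_power_law wr t3 t5) [hG hL].
  have -> : tau - 2 = (tau - 3) + 1 by ring.
  by apply: (crit_exponents_of_cmp wr s0 ds gb _ hG hL); rewrite subr_gt0.
by move=> /(cmp_power_law5 wr); exact: (boundary_case_of_cmp wr s0 ds gb).
Qed.
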